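(* Let $C$ be a hyperelliptic curve defined over $\mathbb{Q}$ of genus $g\in\{2,3\}$ with Jacobian $J$. If $J(\mathbb{Q})$ is trivial, then $C(K)=C(\mathbb{Q})$ for all primitive quartic number fields $K$. However, there are infinitely many imprimitive quartic number fields $K$ such that $C(K)\neq C(\mathbb{Q})$.
   Context: A curve over a field $K$ is a smooth projective geometrically irreducible variety of dimension $1$ over $K$. A curve $C$ over $K$ is hyperelliptic if its genus is at least $2$ and it admits a degree $2$ morphism $C\to\mathbb{P}^1$ defined over $K$. A number field $K$ is primitive if the only subfields of $K$ are $\mathbb{Q}$ and $K$; otherwise (i.e. if there is a field $L$ with $\mathbb{Q}\subsetneq L\subsetneq K$) it is imprimitive. *)

(* Defs.v *)
From HB Require Import structures.
From mathcomp Require Import all_boot all_order all_algebra all_field.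
From mathcomp Require Import generic_quotient boolp freeg mpoly ring.

Set Implicit Arguments.
Unset Strict Implicit.
Unset Printing Implicit Defensive.

Import Order.TTheory GRing.Theory Num.Theory.
Local Open Scope ring_scope.
Local Open Scope quotient_scope.

(* Throughout, algC (the complex algebraic numbers) plays the role of an
   algebraic closure of Q, and a field extension of Q is a field K with a
   ring morphism iota : rat -> K. *)

Record proj_scheme := ProjScheme {
  amb : nat;
  eqns : seq {mpoly rat[amb.+1]};
  eqns_homog : all (fun p => p \is homog mdeg) eqns
}.

(* Homogeneous coordinates of a point of P^n(K) are made unique by requiring
   the first nonzero one to be 1. *)
Definition normalized (K : fieldType) (n : nat) (v : 'rV[K]_n.+1) : bool :=
  [exists i, (v 0 i == 1) && [forall j : 'I_n.+1, (j < i)%N ==> (v 0 j == 0)]].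

Definition on_scheme (X : proj_scheme) (K : fieldType)
    (iota : {rmorphism rat -> K}) (v : 'rV[K]_(amb X).+1) : bool :=
  all (fun p => (map_mpoly iota p).@[v 0] == 0) (eqns X).

Section Points.
Variables (X : proj_scheme) (K : fieldType) (iota : {rmorphism rat -> K}).

Record point := Point {
  coords :> 'rV[K]_(amb X).+1;
  coordsP : normalized coords && on_scheme iota coords
}.

HB.instance Definition _ := [isSub for coords].
HB.instance Definition _ := [Choice of point by <:].

End Points.

Notation Qpoint X := (@point X rat idfun).
Notation Cpoint X := (@point X algC ratr).

Definition no_new_points (X : proj_scheme) (K : fieldType)
    (iota : {rmorphism rat -> K}) : Prop :=
  forall P : point X iota, exists R : Qpoint X,
    coords P = map_mx iota (coords R).

Definition proj_space (n : nat) : proj_scheme :=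
  @ProjScheme n [::] isT.

Section Zariski.
Variable X : proj_scheme.
Implicit Types Z : Cpoint X -> Prop.

Definition zclosed Z : Prop :=
  exists S : {mpoly algC[(amb X).+1]} -> Prop,
    (forall p, S p -> p \is homog mdeg) /\
    (forall P : Cpoint X, Z P <-> (forall p, S p -> p.@[P 0] = 0)).

Definition zsubset Z1 Z2 : Prop := forall P, Z1 P -> Z2 P.

Definition zirreducible Z : Prop :=
  (exists P, Z P) /\
  forall Z1 Z2, zclosed Z1 -> zclosed Z2 ->
    zsubset Z (fun P => Z1 P \/ Z2 P) -> zsubset Z Z1 \/ zsubset Z Z2.

Definition has_chain (d : nat) : Prop :=
  exists Z : 'I_d.+1 -> Cpoint X -> Prop,
    (forall i, zclosed (Z i) /\ zirreducible (Z i)) /\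
    (forall i j : 'I_d.+1, (i < j)%N ->
       zsubset (Z i) (Z j) /\ ~ zsubset (Z j) (Z i)).

Definition krull_dim (d : nat) : Prop := has_chain d /\ ~ has_chain d.+1.

Definition jacobian_matrix (P : Cpoint X) :
    'M[algC]_(size (eqns X), (amb X).+1) :=
  \matrix_(i, j) (map_mpoly ratr ((eqns X)`_i)^`M(j)).@[P 0].

(* Jacobian criterion; it expresses smoothness of X over Q when X has pure
   dimension d. *)
Definition smooth (d : nat) : Prop :=
  forall P : Cpoint X, (\rank (jacobian_matrix P) + d)%N = amb X.

End Zariski.

Record curve := Curve {
  scheme_of :> proj_scheme;
  geom_irreducible : @zirreducible scheme_of (fun _ => True);
  curve_dim : krull_dim scheme_of 1;
  curve_smooth : smooth scheme_of 1
}.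

(* The function field of C over algC: its elements are fractions A / B of forms of the
   same degree, B not vanishing identically on C, and A / B = A' / B' when
   A B' - A' B vanishes on C. *)

Section FunctionField.
Variable C : curve.
Notation M := {mpoly algC[(amb C).+1]}.

Definition vanishes (A : M) : Prop := forall P : Cpoint C, A.@[P 0] = 0.

Definition is_fraction (x : M * M) : Prop :=
  (exists d, x.1 \is d.-homog /\ x.2 \is d.-homog) /\ ~ vanishes x.2.

Record fraction := Fraction {
  fracval :> M * M;
  fracvalP : `[< is_fraction fracval >]
}.

HB.instance Definition _ := [isSub for fracval].
HB.instance Definition _ := [Choice of fraction by <:].

Lemma vanishes0 : vanishes 0.
Proof. by move=> P; rewrite meval0. Qed.

Lemma vanishesN A : vanishes A -> vanishes (- A).
Proof. by move=> vA P; rewrite mevalN vA oppr0. Qed.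

Lemma vanishesD A B : vanishes A -> vanishes B -> vanishes (A + B).
Proof. by move=> vA vB P; rewrite mevalD vA vB addr0. Qed.

Lemma vanishesMr A B : vanishes B -> vanishes (A * B).
Proof. by move=> vB P; rewrite mevalM vB mulr0. Qed.

Lemma vanishes1 : ~ vanishes 1.
Proof.
by have [[P _] _] := geom_irreducible C; move=> /(_ P)/eqP; rewrite meval1 oner_eq0.
Qed.

Lemma vanishesM d e A B : A \is d.-homog -> B \is e.-homog ->
  vanishes (A * B) -> vanishes A \/ vanishes B.
Proof.
move=> hA hB vAB.
pose V D (P : Cpoint C) := D.@[P 0] = 0.
have cl f D : D \is f.-homog -> zclosed (V D).
  move=> hD; exists (fun p => p = D); split=> [p ->|P].
    exact: homogE hD.
  by split=> [vD p ->//|]; apply.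
have [_ /(_ (V A) (V B) (cl _ _ hA) (cl _ _ hB))] := geom_irreducible C.
case=> [P _|sA|sB]; last 2 first.
- by left=> P; apply: sA.
- by right=> P; apply: sB.
have /eqP := vAB P; rewrite mevalM mulf_eq0.
by case/orP=> /eqP; [left|right].
Qed.

Lemma is_fraction_fracval (x : fraction) : is_fraction x.
Proof. by have /asboolP := fracvalP x. Qed.

Definition eqfrac (x y : fraction) : bool :=
  `[< vanishes (x.1 * y.2 - y.1 * x.2) >].

Lemma eqfrac_refl : reflexive eqfrac.
Proof. by move=> x; apply/asboolP; rewrite subrr; apply: vanishes0. Qed.

Lemma eqfrac_sym x y : eqfrac x y = eqfrac y x.
Proof.
by apply/asboolP/asboolP => /vanishesN; rewrite opprB.
Qed.

Lemma eqfrac_trans : transitive eqfrac.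
Proof.
move=> y x z /asboolP xy /asboolP yz; apply/asboolP.
have [[dx [hx1 hx2]] _] := is_fraction_fracval x.
have [[dy [hy1 hy2]] ny] := is_fraction_fracval y.
have [[dz [hz1 hz2]] _] := is_fraction_fracval z.
have hD : x.1 * z.2 - z.1 * x.2 \is (dx + dz).-homog.
  by apply: rpredB; last rewrite addnC; apply: dhomogM.
case: (vanishesM hy2 hD) => // P.
have -> : y.2 * (x.1 * z.2 - z.1 * x.2) =
  z.2 * (x.1 * y.2 - y.1 * x.2) + x.2 * (y.1 * z.2 - z.1 * y.2) by ring.
exact: vanishesD (vanishesMr _ xy) (vanishesMr _ yz) P.
Qed.

Canonical eqfrac_equiv :=
  EquivRel eqfrac eqfrac_refl eqfrac_sym eqfrac_trans.

Definition funfield := {eq_quot eqfrac}.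

HB.instance Definition _ : EqQuotient _ eqfrac funfield :=
  EqQuotient.on funfield.
HB.instance Definition _ := Choice.on funfield.

Lemma is_fraction0 : is_fraction (0, 1).
Proof.
split; last exact: vanishes1.
by exists 0%N; split; [exact: rpred0 | exact: dhomog1].
Qed.

(* junk value 0 when (A, B) is not a fraction *)
Definition mkfrac (A B : M) : fraction :=
  insubd (Fraction (asboolT is_fraction0)) (A, B).

Definition ratio (A B : M) : funfield := \pi_funfield (mkfrac A B).

Lemma mkfracE A B : is_fraction (A, B) -> fracval (mkfrac A B) = (A, B).
Proof. by move=> h; rewrite /mkfrac val_insubd; case: asboolP. Qed.

Lemma pi_fracP (x y : fraction) :
  vanishes (x.1 * y.2 - y.1 * x.2) <-> \pi_funfield x = \pi_funfield y.
Proof.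
split=> [h|/eqmodP /asboolP //]; by apply/eqmodP/asboolP.
Qed.

Lemma ratioP A B A' B' : is_fraction (A, B) -> is_fraction (A', B') ->
  (ratio A B = ratio A' B' <-> vanishes (A * B' - A' * B)).
Proof. by move=> h h'; rewrite /ratio -pi_fracP !mkfracE. Qed.

Lemma ratio_ind (T : funfield -> Prop) :
  (forall A B, is_fraction (A, B) -> T (ratio A B)) -> forall f, T f.
Proof.
move=> hT; elim/quotW=> x.
have hx := is_fraction_fracval x.
suff -> : \pi_funfield x = ratio x.1 x.2 by apply: hT; rewrite -surjective_pairing.
by congr \pi; apply: val_inj; rewrite /= mkfracE -surjective_pairing.
Qed.

Lemma is_fractionD A B A' B' : is_fraction (A, B) -> is_fraction (A', B') ->
  is_fraction (A * B' + A' * B, B * B').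
Proof.
move=> [[d /= [hA hB]] nB] [[e /= [hA' hB']] nB']; split=> /=.
  exists (d + e)%N; split; last exact: dhomogM.
  by apply: rpredD; last rewrite addnC; apply: dhomogM.
by move/(vanishesM hB hB') => [].
Qed.

Lemma is_fractionM A B A' B' : is_fraction (A, B) -> is_fraction (A', B') ->
  is_fraction (A * A', B * B').
Proof.
move=> [[d /= [hA hB]] nB] [[e /= [hA' hB']] nB']; split=> /=.
  by exists (d + e)%N; split; apply: dhomogM.
by move/(vanishesM hB hB') => [].
Qed.

Lemma is_fractionN A B : is_fraction (A, B) -> is_fraction (- A, B).
Proof.
move=> [[d /= [hA hB]] nB]; split=> //=.
by exists d; split=> //; rewrite dhomogN.
Qed.

Lemma is_fractionV A B : is_fraction (A, B) -> ~ vanishes A ->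
  is_fraction (B, A).
Proof. by move=> [[d /= [hA hB]] nB] nA; split=> //=; exists d. Qed.

Lemma is_fractionC c : is_fraction (c%:MP, 1).
Proof.
split; last exact: vanishes1.
exists 0%N; split; last exact: dhomog1.
by rewrite -[c%:MP]mulr1 mul_mpolyC; apply/rpredZ/dhomog1.
Qed.

Definition addfrac (x y : fraction) := mkfrac (x.1 * y.2 + y.1 * x.2) (x.2 * y.2).
Definition oppfrac (x : fraction) := mkfrac (- x.1) x.2.
Definition mulfrac (x y : fraction) := mkfrac (x.1 * y.1) (x.2 * y.2).
(* when x.1 vanishes on C, this is the fraction 0 / 1 *)
Definition invfrac (x : fraction) := mkfrac x.2 x.1.

Definition addff (f g : funfield) : funfield :=
  \pi_funfield (addfrac (repr f) (repr g)).
Definition oppff (f : funfield) : funfield := \pi_funfield (oppfrac (repr f)).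
Definition mulff (f g : funfield) : funfield :=
  \pi_funfield (mulfrac (repr f) (repr g)).
Definition invff (f : funfield) : funfield := \pi_funfield (invfrac (repr f)).

Lemma repr_ratio A B : is_fraction (A, B) ->
  exists A' B', [/\ is_fraction (A', B'), vanishes (A' * B - A * B') &
    fracval (repr (ratio A B)) = (A', B')].
Proof.
move=> h; set x := repr _; exists x.1, x.2.
rewrite -surjective_pairing; split=> //; first exact: is_fraction_fracval.
have /pi_fracP : \pi_funfield x = ratio A B by rewrite reprK.
by rewrite mkfracE.
Qed.

Lemma addffE A B A' B' : is_fraction (A, B) -> is_fraction (A', B') ->
  addff (ratio A B) (ratio A' B') = ratio (A * B' + A' * B) (B * B').
Proof.
move=> h h'; rewrite /addff.
have [E [F [hE vE eE]]] := repr_ratio h.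
have [E' [F' [hE' vE' eE']]] := repr_ratio h'.
rewrite /addfrac eE eE' /=; apply/ratioP; try exact: is_fractionD.
have -> : (E * F' + E' * F) * (B * B') - (A * B' + A' * B) * (F * F') =
  (F' * B') * (E * B - A * F) + (F * B) * (E' * B' - A' * F') by ring.
by apply: vanishesD; apply: vanishesMr.
Qed.

Lemma mulffE A B A' B' : is_fraction (A, B) -> is_fraction (A', B') ->
  mulff (ratio A B) (ratio A' B') = ratio (A * A') (B * B').
Proof.
move=> h h'; rewrite /mulff.
have [E [F [hE vE eE]]] := repr_ratio h.
have [E' [F' [hE' vE' eE']]] := repr_ratio h'.
rewrite /mulfrac eE eE' /=; apply/ratioP; try exact: is_fractionM.
have -> : E * E' * (B * B') - A * A' * (F * F') =
  (E' * B') * (E * B - A * F) + (A * F) * (E' * B' - A' * F') by ring.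
by apply: vanishesD; apply: vanishesMr.
Qed.

Lemma oppffE A B : is_fraction (A, B) -> oppff (ratio A B) = ratio (- A) B.
Proof.
move=> h; rewrite /oppff.
have [E [F [hE vE eE]]] := repr_ratio h.
rewrite /oppfrac eE /=; apply/ratioP; try exact: is_fractionN.
have -> : - E * B - - A * F = - (E * B - A * F) by ring.
exact: vanishesN.
Qed.

Lemma ratio_eq0 A B : is_fraction (A, B) -> (ratio A B = ratio 0 1 <-> vanishes A).
Proof. by move=> h; rewrite (ratioP h is_fraction0) mulr1 mul0r subr0. Qed.

Lemma invffE A B : is_fraction (A, B) -> ~ vanishes A ->
  invff (ratio A B) = ratio B A.
Proof.
move=> h nA; rewrite /invff.
have [E [F [hE vE eE]]] := repr_ratio h.
have eq : ratio E F = ratio A B by apply/ratioP.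
rewrite /invfrac eE /=; apply/ratioP.
- by apply: is_fractionV => // /(ratio_eq0 hE); rewrite eq => /(ratio_eq0 h).
- exact: is_fractionV.
have -> : F * A - B * E = - (E * B - A * F) by ring.
exact: vanishesN.
Qed.

Let zeroff := ratio 0 1.
Let oneff := ratio 1 1.

Let is_fraction1 : is_fraction (1, 1).
Proof. by have := is_fractionC 1; rewrite mpolyC1. Qed.

Lemma vanishes_eq0 A : A = 0 -> vanishes A.
Proof. by move=> ->; apply: vanishes0. Qed.

Lemma addffA : associative addff.
Proof.
elim/ratio_ind=> A B h; elim/ratio_ind=> A' B' h'; elim/ratio_ind=> E F hE.
have hl := is_fractionD h' hE; have hr := is_fractionD h h'.
rewrite (addffE h' hE) (addffE h hl) (addffE h h') (addffE hr hE).
apply/ratioP; [exact: is_fractionD..|apply: vanishes_eq0; ring].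
Qed.

Lemma addffC : commutative addff.
Proof.
elim/ratio_ind=> A B h; elim/ratio_ind=> A' B' h'.
rewrite !addffE //; apply/ratioP; [exact: is_fractionD..|].
apply: vanishes_eq0; ring.
Qed.

Lemma add0ff : left_id zeroff addff.
Proof.
elim/ratio_ind=> A B h; rewrite (addffE is_fraction0 h).
by rewrite mul0r add0r mulr1 mul1r.
Qed.

Lemma addNff : left_inverse zeroff oppff addff.
Proof.
elim/ratio_ind=> A B h; have hN := is_fractionN h.
rewrite (oppffE h) (addffE hN h); apply/ratio_eq0; first exact: is_fractionD.
by apply: vanishes_eq0; ring.
Qed.

HB.instance Definition _ :=
  GRing.isZmodule.Build funfield addffA addffC add0ff addNff.

Lemma mulffA : associative mulff.
Proof.
elim/ratio_ind=> A B h; elim/ratio_ind=> A' B' h'; elim/ratio_ind=> E F hE.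
have hl := is_fractionM h' hE; have hr := is_fractionM h h'.
by rewrite (mulffE h' hE) (mulffE h hl) (mulffE h h') (mulffE hr hE) !mulrA.
Qed.

Lemma mulffC : commutative mulff.
Proof.
elim/ratio_ind=> A B h; elim/ratio_ind=> A' B' h'.
by rewrite !mulffE // [A * _]mulrC [B * _]mulrC.
Qed.

Lemma mul1ff : left_id oneff mulff.
Proof. by elim/ratio_ind=> A B h; rewrite (mulffE is_fraction1 h) !mul1r. Qed.

Lemma mulffDl : left_distributive mulff addff.
Proof.
elim/ratio_ind=> A B h; elim/ratio_ind=> A' B' h'; elim/ratio_ind=> E F hE.
have h1 := is_fractionD h h'; have h2 := is_fractionM h hE.
have h3 := is_fractionM h' hE.
rewrite (addffE h h') (mulffE h1 hE) (mulffE h hE) (mulffE h' hE) (addffE h2 h3).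
apply/ratioP; [exact: is_fractionM | exact: is_fractionD |].
by apply: vanishes_eq0; ring.
Qed.

Lemma oneff_neq0 : oneff != zeroff.
Proof. by apply/eqP=> /(ratio_eq0 is_fraction1)/vanishes1. Qed.

HB.instance Definition _ := GRing.Zmodule_isComNzRing.Build funfield
  mulffA mulffC mul1ff mulffDl oneff_neq0.

Lemma mulVff (f : funfield) : f != 0 -> mulff (invff f) f = 1.
Proof.
elim/ratio_ind: f => A B h nz.
have nA : ~ vanishes A by move=> /(ratio_eq0 h) /eqP; apply/negP.
have hV := is_fractionV h nA.
rewrite (invffE h nA) (mulffE hV h); apply/ratioP => //.
  exact: is_fractionM.
by apply: vanishes_eq0; ring.
Qed.

Lemma invff0 : invff 0 = 0.
Proof.
rewrite /invff /invfrac; have [E [F [hE vE ->]]] := repr_ratio is_fraction0.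
have vE0 : vanishes E by move: vE; rewrite mulr1 mul0r subr0.
rewrite /=; congr \pi; apply: val_inj.
rewrite /mkfrac !val_insubd; case: asboolP => [[_ /= nE] //|_].
by case: asboolP.
Qed.

HB.instance Definition _ :=
  GRing.ComNzRing_isField.Build funfield mulVff invff0.

Definition cst (c : algC) : funfield := ratio c%:MP 1.

Lemma cst_is_zmod_morphism : zmod_morphism cst.
Proof.
move=> c e; rewrite /cst.
have -> : ratio c%:MP 1 - ratio e%:MP 1 =
  addff (ratio c%:MP 1) (oppff (ratio e%:MP 1)) by [].
have h := is_fractionC; have hN := is_fractionN (h e).
by rewrite (oppffE (h e)) (addffE (h c) hN) !mulr1 mpolyCB.
Qed.

Lemma cst_is_monoid_morphism : monoid_morphism cst.
Proof.
split=> [|c e]; first by rewrite /cst mpolyC1.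
have -> : cst c * cst e = mulff (cst c) (cst e) by [].
by rewrite (mulffE (is_fractionC c) (is_fractionC e)) mulr1 /cst mpolyCM.
Qed.

HB.instance Definition _ :=
  GRing.isZmodMorphism.Build algC funfield cst cst_is_zmod_morphism.
HB.instance Definition _ :=
  GRing.isMonoidMorphism.Build algC funfield cst cst_is_monoid_morphism.

End FunctionField.

Section Divisors.
Variable C : curve.
Notation F := (funfield C).
Notation M := {mpoly algC[(amb C).+1]}.

Definition represents (A B : M) (f : F) : Prop :=
  is_fraction (C := C) (A, B) /\ f = ratio A B.

(* f lies in the local ring of C at P and f(P) = c; so f lies in the maximal
   ideal when c = 0 and is a unit of the local ring when c <> 0. *)
Definition has_value (P : Cpoint C) (f : F) (c : algC) : Prop :=
  exists A B : M,
    [/\ represents A B f, B.@[P 0] != 0 & c = A.@[P 0] / B.@[P 0]].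

Definition uniformizer (P : Cpoint C) (pi : F) : Prop :=
  has_value P pi 0 /\
  forall f, has_value P f 0 -> exists h c, has_value P h c /\ f = h * pi.

Definition has_order (P : Cpoint C) (f : F) (k : int) : Prop :=
  exists pi u c, [/\ uniformizer P pi, has_value P u c, c != 0 & f = u * pi ^ k].

Definition divisor := {freeg (Cpoint C) / int}.

Definition principal (D : divisor) : Prop :=
  exists f : F, f != 0 /\ forall P : Cpoint C, has_order P f (coeff P D).

Definition lin_equiv (D D' : divisor) : Prop := principal (D - D').

(* For a subfield S of F and an S-subspace V of F: V has an S-basis of size d. *)
Definition dim_over (S V : F -> Prop) (d : nat) : Prop :=
  exists b : 'I_d -> F, (forall i, V (b i)) /\
    forall f, V f -> exists! c : {ffun 'I_d -> F},
      (forall i, S (c i)) /\ f = \sum_i c i * b i.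

Definition constants (f : F) : Prop := exists c : algC, f = cst C c.

Definition riemann_roch (D : divisor) (f : F) : Prop :=
  f = 0 \/ forall P : Cpoint C, exists k, has_order P f k /\ - coeff P D <= k.

Definition ell (D : divisor) (r : nat) : Prop :=
  dim_over constants (riemann_roch D) r.

(* Riemann's definition: g is the maximum of deg D + 1 - l(D) over all D *)
Definition genus (g : nat) : Prop :=
  (forall D r, ell D r -> deg D + 1 - r%:Z <= g%:Z) /\
  (exists D r, ell D r /\ deg D + 1 - r%:Z = g%:Z).

End Divisors.

Section GaloisAction.
Variables (C : curve) (s : {rmorphism algC -> algC}).

Lemma meval_galois n (p : {mpoly rat[n]}) (v : 'I_n -> algC) :
  (map_mpoly ratr p).@[s \o v] = s (map_mpoly ratr p).@[v].
Proof.
elim/mpolyind: p => [|c m p _ _ IH]; first by rewrite raddf0 !meval0 rmorph0.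
rewrite raddfD /= map_mpolyZ map_mpolyX !mevalD !mevalZ !mevalX IH.
rewrite rmorphD rmorphM rmorph_prod fmorph_rat; congr (_ * _ + _).
by apply: eq_bigr => i _; rewrite rmorphXn.
Qed.

Lemma galois_coordsP (P : Cpoint C) :
  normalized (map_mx s P) && on_scheme (X := C) ratr (map_mx s P).
Proof.
have /andP[/existsP[i /andP[/eqP Pi /forallP Pj]] /allP onP] := coordsP P.
apply/andP; split.
  apply/existsP; exists i; rewrite mxE Pi rmorph1 eqxx /=.
  apply/forallP=> j; apply/implyP=> ji.
  by rewrite mxE (eqP (implyP (Pj j) ji)) rmorph0.
apply/allP=> p /onP /eqP e; apply/eqP.
rewrite (@meval_eq _ _ _ (s \o P 0)) => [|j]; last by rewrite mxE.
by rewrite meval_galois e rmorph0.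
Qed.

Definition galois_point (P : Cpoint C) : Cpoint C :=
  Point (galois_coordsP P).

Definition galois_divisor (D : divisor C) : divisor C :=
  fglift (fun P => << galois_point P >>) D.

End GaloisAction.

(* J(Q) is the group of Galois-invariant elements of
   J(algC) = Pic^0(C over algC); ring endomorphisms of algC are exactly the
   elements of Gal(algC / Q). *)
Definition JQ_class (C : curve) (D : divisor C) : Prop :=
  deg D = 0 /\
  forall s : {rmorphism algC -> algC}, lin_equiv (galois_divisor s D) D.

Definition JQ_trivial (C : curve) : Prop :=
  forall D : divisor C, JQ_class D -> lin_equiv D 0.

Section Hyperelliptic.
Variable C : curve.
Notation F := (funfield C).

Section Morphism.
Variable phi : Cpoint C -> Cpoint (proj_space 1).

(* phi = [A : B] wherever A and B do not both vanish *)
Definition given_by (A B : {mpoly algC[(amb C).+1]}) : Prop :=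
  forall P : Cpoint C, (A.@[P 0] != 0) || (B.@[P 0] != 0) ->
    A.@[P 0] * (phi P : 'rV_2) 0 1 = B.@[P 0] * (phi P : 'rV_2) 0 0.

Definition Qmorphism : Prop :=
  forall P : Cpoint C, exists (A B : {mpoly rat[(amb C).+1]}) (d : nat),
    let A' := map_mpoly ratr A in let B' := map_mpoly ratr B in
    [/\ A \is d.-homog, B \is d.-homog,
        (A'.@[P 0] != 0) || (B'.@[P 0] != 0) & given_by A' B'].

(* t is the pullback by phi of the coordinate X_0 / X_1 of P^1 *)
Definition pullback (t : F) : Prop :=
  exists A B, represents A B t /\ given_by A B.

(* the function field Q(C), as a subfield of F *)
Definition Qfunfield (f : F) : Prop :=
  exists A B : {mpoly rat[(amb C).+1]},
    represents (map_mpoly ratr A) (map_mpoly ratr B) f.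

Definition Qgenerated (t f : F) : Prop :=
  exists p q : {poly rat},
    let ev r := (map_poly (cst C \o ratr) r).[t] in
    ev q != 0 /\ f = ev p / ev q.

(* the degree of phi : C -> P^1, that is [Q(C) : phi^* Q(P^1)] *)
Definition degree (d : nat) : Prop :=
  exists t, pullback t /\ dim_over (Qgenerated t) Qfunfield d.

End Morphism.

Definition hyperelliptic : Prop :=
  (exists g, genus C g /\ (2 <= g)%N) /\
  (exists phi, Qmorphism phi /\ degree phi 2).

End Hyperelliptic.

Definition primitive_field (K : fieldExtType rat) : Prop :=
  forall L : {subfield K}, L = 1%AS \/ L = {: K}%AS.

Definition field_iso (K L : fieldExtType rat) : Prop :=
  exists f : {rmorphism K -> L}, bijective f.

(* Main.v *)
Require Import Defs.
From HB Require Import structures.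
From mathcomp Require Import generic_quotient boolp freeg mpoly.
From mathcomp Require Import all_boot all_order all_algebra all_field ring zify.

Set Implicit Arguments.
Unset Strict Implicit.
Unset Printing Implicit Defensive.

Import Order.TTheory GRing.Theory Num.Theory.
Local Open Scope ring_scope.

(* Let t be the pullback of the coordinate of P^1, a function of degree 2 with polar divisor E.
   If P is a point over a primitive quartic field that is not rational, its four conjugates are
   distinct and their sum minus 2E is a Galois-invariant divisor of degree 0, hence the divisor
   of a function f in L(2E) = <1, t, t^2>. So t(P) is infinite or a root of a nonzero polynomial
   of degree 2 having all the conjugates of t(P) as roots; by primitivity t(P) is rational or
   infinite, and then a fibre of t contains four points, which is absurd. Conversely, at most
   one point is rational, since a function with divisor P - Q would force genus 0; so the fibre
   of t over 0 or 1 contains a point that is quadratic over Q, and this point is defined over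
   all the biquadratic fields that contain its field of definition.

   No geometry of the curve is used beyond its local rings: the finiteness of Riemann's genus
   implies that the points of C carry uniformizers, that functions have finitely many zeros and
   poles and are constant if they have no pole, and that principal divisors have degree 0. *)

(** * Linear independence over the constants *)

Section LinearIndependence.
Variables (k F : fieldType) (emb : {rmorphism k -> F}).
Implicit Types V W : F -> Prop.

Definition lin_indep r (b : 'I_r -> F) : Prop :=
  forall c : 'I_r -> k, \sum_i emb (c i) * b i = 0 -> forall i, c i = 0.

Definition dim_ge V r : Prop :=
  exists b : 'I_r -> F, (forall i, V (b i)) /\ lin_indep b.

Definition dim_eq V r : Prop := dim_ge V r /\ ~ dim_ge V r.+1.

Definition subspace V : Prop :=
  V 0 /\ forall c f g, V f -> V g -> V (emb c * f + g).

Lemma subspace_sum V (r : nat) (c : 'I_r -> k) (b : 'I_r -> F) :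
  subspace V -> (forall i, V (b i)) -> V (\sum_i emb (c i) * b i).
Proof.
move=> [V0 VD] Vb; elim/big_rec: _ => // i f _; exact: VD.
Qed.

Lemma dim_ge0 V : dim_ge V 0.
Proof. by exists (fun _ => 0); split=> [[]|c _ []]. Qed.

Lemma dim_ge_sub V W r : (forall f, V f -> W f) -> dim_ge V r -> dim_ge W r.
Proof. by move=> sVW [b [Vb ib]]; exists b; split=> // i; apply: sVW. Qed.

Lemma dim_ge_le V r s : (s <= r)%N -> dim_ge V r -> dim_ge V s.
Proof.
move=> /subnKC <-; elim: (r - s)%N => [|n IH]; rewrite ?addn0 // addnS.
move=> [b [Vb ib]]; apply: IH; exists (fun i => b (lift ord0 i)); split=> // c sum0 i.
pose c' l := if unlift ord0 l is Some i then c i else 0.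
have -> : c i = c' (lift ord0 i) by rewrite /c' liftK.
apply: ib; rewrite big_ord_recl {1}/c' unlift_none rmorph0 mul0r add0r -[RHS]sum0.
by apply: eq_bigr => j _; rewrite /c' liftK.
Qed.

Lemma dim_eq_ex V n : ~ dim_ge V n.+1 -> exists2 r, (r <= n)%N & dim_eq V r.
Proof.
elim: n => [|n IH] nV; first by exists 0%N => //; split=> //; apply: dim_ge0.
have [VN|/IH [r rn dr]] := EM (dim_ge V n.+1); first by exists n.+1.
by exists r => //; apply: leqW.
Qed.

Lemma dim_geS V W f r : subspace V -> (forall g, V g -> W g) -> W f -> ~ V f ->
  dim_ge V r -> dim_ge W r.+1.
Proof.
move=> sV sVW Wf nVf [b [Vb ib]].
exists (fun i => if unlift ord0 i is Some j then b j else f); split=> [i|c].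
  by case: unlift => // j; apply: sVW.
rewrite big_ord_recl unlift_none; under eq_bigr do rewrite liftK.
move=> sum0; have c0 : c ord0 = 0.
  apply: contrapT => /eqP c0; apply: nVf.
  have -> : f = emb (- (c ord0)^-1) * (\sum_(i < r) emb (c (lift ord0 i)) * b i) + 0.
    move/eqP: sum0; rewrite addrC addr_eq0 => /eqP ->.
    by rewrite addr0 rmorphN mulrNN mulrA -rmorphM mulVf // rmorph1 mul1r.
  by case: (sV) => V0 VD; apply: VD => //; apply: subspace_sum.
move: sum0; rewrite c0 rmorph0 mul0r add0r => /ib ci i.
by have [j ->|->] := unliftP ord0 i.
Qed.

Lemma dim_ge_codim1 V W r : subspace V ->
  (forall f g, W f -> W g -> ~ V f -> exists c, V (g - emb c * f)) ->
  dim_ge W r.+1 -> dim_ge V r.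
Proof.
move=> sV codim [b [Wb ib]].
have [Vb|] := EM (forall i, V (b i)).
  by apply: (@dim_ge_le _ r.+1) => //; exists b.
move/existsNP=> [j nVj].
have /choice [c cP] : forall i, exists c, V (b (lift j i) - emb c * b j).
  by move=> i; apply: codim.
exists (fun i => b (lift j i) - emb (c i) * b j); split=> // d sum0 i.
pose d' l := if unlift j l is Some i then d i else - \sum_i d i * c i.
have -> : d i = d' (lift j i) by rewrite /d' liftK.
apply: ib; rewrite (bigD1_ord j) //= -[RHS]sum0 {1}/d' unlift_none.
under eq_bigr do rewrite /d' liftK.
under [RHS]eq_bigr do rewrite mulrBr mulrA -rmorphM.
by rewrite sumrB -mulr_suml -rmorph_sum rmorphN mulNr addrC.
Qed.

Lemma dim_ge_scale V W f r : f != 0 -> (forall g, V g -> W (f * g)) ->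
  dim_ge V r -> dim_ge W r.
Proof.
move=> f0 VW [b [Vb ib]]; exists (fun i => f * b i); split=> [i|c sum0].
  exact: VW.
apply: ib; apply: (mulfI f0); rewrite mulr0 -[RHS]sum0 mulr_sumr.
by apply: eq_bigr => i _; rewrite mulrCA.
Qed.

Lemma dim_eq_coord V r : subspace V -> dim_eq V r ->
  exists b : 'I_r -> F, (forall i, V (b i)) /\
    forall f, V f -> exists! c : {ffun 'I_r -> F},
      (forall i, exists a, c i = emb a) /\ f = \sum_i c i * b i.
Proof.
move=> sV [[b [Vb ib]] nV]; exists b; split=> // f Vf.
have [c fE] : exists c : 'I_r -> k, f = \sum_i emb (c i) * b i.
  apply: contrapT => nf; apply: nV.
  pose W f := exists c : 'I_r -> k, f = \sum_i emb (c i) * b i.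
  apply: (@dim_geS W V f) => //.
  - split=> [|c g h [d ->] [e ->]].
      by exists (fun=> 0); rewrite big1 // => i _; rewrite rmorph0 mul0r.
    exists (fun i => c * d i + e i); rewrite mulr_sumr -big_split /=.
    by apply: eq_bigr => i _; rewrite rmorphD rmorphM mulrDl mulrA.
  - by move=> g [c ->]; apply: subspace_sum.
  exists b; split=> // i; exists (fun j => (j == i)%:R).
  rewrite (bigD1 i) //= eqxx rmorph1 mul1r big1 ?addr0 // => j /negbTE ->.
  by rewrite rmorph0 mul0r.
exists [ffun i => emb (c i)]; split=> [|d [/choice[e eE] fd]].
  split=> [i|]; first by exists (c i); rewrite ffunE.
  by rewrite fE; apply: eq_bigr => i _; rewrite ffunE.
apply/ffunP=> i; rewrite ffunE eE; congr (emb _).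
apply/eqP; rewrite -subr_eq0; apply/eqP.
apply: (ib (fun i => c i - e i)).
under eq_bigr do rewrite rmorphB mulrBl -eE.
by rewrite sumrB -fE -fd subrr.
Qed.

Lemma coord_dim_eq V r :
  (exists b : 'I_r -> F, (forall i, V (b i)) /\
    forall f, V f -> exists! c : {ffun 'I_r -> F},
      (forall i, exists a, c i = emb a) /\ f = \sum_i c i * b i) ->
  V 0 -> dim_eq V r.
Proof.
move=> [b [Vb bP]] V0; split.
  exists b; split=> // c sum0 i.
  have [d [_ dU]] := bP _ V0.
  have d0 : d = [ffun=> 0].
    apply: dU; split=> [j|]; first by exists 0; rewrite ffunE rmorph0.
    by rewrite big1 // => j _; rewrite ffunE mul0r.
  have /ffunP/(_ i) : d = [ffun j => emb (c j)].
    apply: dU; split=> [j|]; first by exists (c j); rewrite ffunE.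
    by rewrite -[LHS]sum0; apply: eq_bigr => j _; rewrite ffunE.
  by rewrite d0 !ffunE => /esym/eqP; rewrite fmorph_eq0 => /eqP.
move=> [e [Ve ie]].
have /choice [A eA] : forall j, exists a : 'I_r -> k, e j = \sum_i emb (a i) * b i.
  move=> j; have [c [[/choice[a aE] ->] _]] := bP _ (Ve j).
  by exists a; apply: eq_bigr => i _; rewrite aE.
pose M : 'M[k]_(r.+1, r) := \matrix_(j, i) A j i.
have /eqP/rowV0Pn[v /sub_kermxP vM] : kermx M <> 0.
  apply/eqP; rewrite -mxrank_eq0 mxrank_ker subn_eq0 -ltnNge ltnS.
  exact: rank_leq_col.
case/eqP; apply/rowP=> j; rewrite mxE; apply: (ie (v 0)).
under eq_bigr do rewrite eA mulr_sumr.
rewrite exchange_big big1 //= => i _.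
under eq_bigr do rewrite mulrA -rmorphM.
rewrite -mulr_suml -rmorph_sum.
have /rowP/(_ i) := vM; rewrite !mxE => s0.
suff -> : \sum_j0 v 0 j0 * A j0 i = 0 by rewrite rmorph0 mul0r.
by rewrite -[RHS]s0; apply: eq_bigr => l _; rewrite mxE.
Qed.

End LinearIndependence.

Section Evaluation.
Variables (k : closedFieldType) (F : fieldType) (emb : {rmorphism k -> F}).
Implicit Types (p q : {poly k}) (t f : F).

Definition ev t p : F := (map_poly emb p).[t].

Lemma evD t p q : ev t (p + q) = ev t p + ev t q.
Proof. by rewrite /ev rmorphD hornerD. Qed.

Lemma evN t p : ev t (- p) = - ev t p.
Proof. by rewrite /ev rmorphN hornerN. Qed.

Lemma evM t p q : ev t (p * q) = ev t p * ev t q.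
Proof. by rewrite /ev rmorphM hornerM. Qed.

Lemma evC t c : ev t c%:P = emb c.
Proof. by rewrite /ev map_polyC hornerC. Qed.

Lemma evX t : ev t 'X = t.
Proof. by rewrite /ev map_polyX hornerX. Qed.

Lemma evXn t n : ev t 'X^n = t ^+ n.
Proof. by rewrite /ev map_polyXn hornerXn. Qed.

Lemma ev0 t : ev t 0 = 0.
Proof. by rewrite /ev rmorph0 horner0. Qed.

Lemma ev_coef t p n : (size p <= n)%N -> ev t p = \sum_(i < n) emb p`_i * t ^+ i.
Proof.
move=> pn; rewrite /ev (@horner_coef_wide _ n) ?size_map_poly //.
by apply: eq_bigr => i _; rewrite coef_map.
Qed.

Definition constant f : Prop := exists c, f = emb c.

Lemma ev_eq0 t p : ~ constant t -> ev t p = 0 -> p = 0.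
Proof.
move=> nt tp; have [r pE] := closed_field_poly_normal p.
move/eqP: tp; rewrite {1}pE -mul_polyC evM evC mulf_eq0 fmorph_eq0 lead_coef_eq0.
case/orP=> [/eqP //|].
rewrite -[_ == 0]/(root _ _) /ev; elim: r {pE} => [|c r IH].
  by rewrite big_nil rmorph1 /root hornerC oner_eq0.
rewrite big_cons rmorphM rootM; case/orP=> [|/IH //].
rewrite rmorphB /= map_polyX map_polyC root_XsubC => /eqP tc.
by case: nt; exists c.
Qed.

(* For nonconstant t this says that F has degree at most d over k(t). *)
Definition dep d t : Prop :=
  forall z : 'I_d.+1 -> F, exists q : 'I_d.+1 -> {poly k},
    (exists i, ev t (q i) != 0) /\ \sum_i ev t (q i) * z i = 0.

(* Dividing a relation by a power of 'X - a makes its value at a nontrivial. *)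
Lemma dep_nonvanishing d t a (z : 'I_d.+1 -> F) : dep d t -> ~ constant t ->
  exists q : 'I_d.+1 -> {poly k},
    (exists i, (q i).[a] != 0) /\ \sum_i ev t (q i) * z i = 0.
Proof.
move=> dt nt; have [q [[i0 qi0] sq]] := dt z.
have {qi0} qi0 : q i0 != 0 by apply: contra_neq qi0 => ->; rewrite ev0.
have [n] := ubnP (\sum_i size (q i))%N.
elim: n => // n IH in q i0 qi0 sq *; rewrite ltnS => sz.
have [qa|] := EM (forall i, root (q i) a); last first.
  by move=> /existsNP[i /negP qa]; exists q; split=> //; exists i.
have /choice [r rE] : forall i, exists r, q i = r * ('X - a%:P).
  by move=> i; have /factor_theorem := qa i.
have szM (p : {poly k}) : p != 0 -> size (p * ('X - a%:P)) = (size p).+1.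
  by move=> p0; rewrite size_Mmonic ?monicXsubC // size_XsubC addn2.
have rn0 i : (size (r i) <= size (q i))%N.
  have [->|r0] := eqVneq (r i) 0; first by rewrite size_poly0.
  by rewrite rE szM.
apply: (IH r i0).
- by apply: contra_neq qi0; rewrite rE => ->; rewrite mul0r.
- have t0 : ev t ('X - a%:P) != 0.
    by rewrite evD evN evX evC subr_eq0; apply/eqP=> ta; apply: nt; exists a.
  apply: (mulIf t0); rewrite mul0r -[RHS]sq mulr_suml.
  by apply: eq_bigr => i _; rewrite rE evM mulrAC.
- apply: leq_trans sz; rewrite [X in (X < _)%N](bigD1 i0) // [X in (_ < X)%N](bigD1 i0) //=.
  rewrite -addSn leq_add ?leq_sum // rE szM //.
  by apply: contra_neq qi0; rewrite rE => ->; rewrite mul0r.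
Qed.

(* A relation over k[t] becomes one over k[t^-1] by reversing the coefficients. *)
Lemma depV d t : dep d t -> t != 0 -> dep d t^-1.
Proof.
move=> dt t0 z; have [q [[i0 qi0] sq]] := dt z.
pose n := (\max_i size (q i))%N.
have qn i : (size (q i) <= n)%N by apply: (@leq_bigmax _ (fun i => size (q i))).
pose r i := \poly_(j < n) (q i)`_(n.-1 - j).
have rE i : ev t^-1 (r i) = t^-1 ^+ n.-1 * ev t (q i).
  rewrite (@ev_coef _ (r i) n) ?size_poly // (ev_coef t (qn i)) mulr_sumr.
  rewrite (reindex_inj rev_ord_inj) /=; apply: eq_bigr => j _.
  have jn := ltn_ord j.
  have -> : n.-1 = (n - j.+1 + j)%N by lia.
  rewrite coef_poly ltn_subrL /=.
  have -> : (0 < n)%N by lia.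
  have -> : (n.-1 - (n - j.+1) = j)%N by lia.
  by rewrite mulrCA exprD -mulrA -[_ ^+ j * _]exprMn mulVf // expr1n mulr1.
exists r; split; first by exists i0; rewrite rE mulf_neq0 // expf_neq0 // invr_eq0.
under eq_bigr do rewrite rE -mulrA.
by rewrite -mulr_sumr sq mulr0.
Qed.

Lemma dep_algebraic d t f : dep d t -> exists Q : {poly F},
  [/\ Q != 0, Q.[f] = 0 & forall i, exists p, Q`_i = ev t p].
Proof.
move=> /(_ (fun i => f ^+ i)) [q [[i0 qi0] sq]].
exists (\poly_(i < d.+1) ev t (q (inord i))); split.
- apply: contra_neq qi0 => /(congr1 (fun Q : {poly F} => Q`_i0)).
  by rewrite coef_poly ltn_ord inord_val coef0.
- rewrite horner_poly -[RHS]sq; apply: eq_bigr => i _; by rewrite inord_val.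
- move=> i; rewrite coef_poly; case: ifP => _; first by eexists.
  by exists 0; rewrite ev0.
Qed.

Lemma poly_strip_X (Q : {poly F}) f : Q != 0 -> f != 0 -> Q.[f] = 0 ->
  exists R : {poly F}, [/\ R`_0 != 0, R.[f] = 0 & exists j, forall i, R`_i = Q`_(i + j)].
Proof.
move=> Q0 f0 Qf.
have exj : exists j, Q`_j != 0.
  by exists (size Q).-1; rewrite -lead_coefE lead_coef_eq0.
pose j := ex_minn exj; have [j_nz j_min] : Q`_j != 0 /\ forall i, Q`_i != 0 -> (j <= i)%N.
  by rewrite /j; case: ex_minnP.
exists (drop_poly j Q); split; last by exists j => i; rewrite coef_drop_poly.
- by rewrite coef_drop_poly.
- have tk : take_poly j Q = 0.
    apply/polyP=> i; rewrite coef_take_poly coef0; case: ltnP => // ij.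
    by apply/eqP/negPn/negP=> /j_min; rewrite leqNgt ij.
  move: Qf; rewrite -{1}[Q](poly_take_drop j) tk add0r hornerM hornerXn.
  by move/eqP; rewrite mulf_eq0 expf_eq0 (negbTE f0) andbF orbF => /eqP.
Qed.

End Evaluation.

(** * Function fields of one variable with a finite Riemann genus *)

Section Places.
Variables (k : closedFieldType) (F : fieldType) (emb : {rmorphism k -> F}).
Variables (X : choiceType) (hv : X -> F -> k -> Prop).
Implicit Types (P : X) (f h u : F) (c : k) (n m : int) (D : {freeg X / int}).

Definition regular P f : Prop := exists c, hv P f c.

Definition unif P pi : Prop :=
  hv P pi 0 /\ forall f, hv P f 0 -> exists h c, hv P h c /\ f = h * pi.

Definition horder P f n : Prop :=
  exists pi u c, [/\ unif P pi, hv P u c, c != 0 & f = u * pi ^ n].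

Definition rr D f : Prop :=
  f = 0 \/ forall P, exists n, horder P f n /\ - coeff P D <= n.

(* hv P f c means that f is regular at the place P and takes the value c there. *)
Record places : Prop := Places {
  hv_cst : forall P c, hv P (emb c) c;
  hvD : forall P f h c d, hv P f c -> hv P h d -> hv P (f + h) (c + d);
  hvM : forall P f h c d, hv P f c -> hv P h d -> hv P (f * h) (c * d);
  hvV : forall P f c, hv P f c -> c != 0 -> hv P f^-1 c^-1;
  hv_inj : forall P f c d, hv P f c -> hv P f d -> c = d;
  hv_frac : forall P f, exists h1 h2, [/\ regular P h1, regular P h2 & f = h1 / h2]
}.

Record riemann (g : int) : Prop := Riemann {
  riemann_le : forall D r, subspace emb (rr D) -> dim_eq emb (rr D) r ->
    deg D + 1 - r%:Z <= g;
  riemann_eq : exists D r, dim_eq emb (rr D) r /\ deg D + 1 - r%:Z = g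
}.

Hypothesis pl : places.
Variables (x0 : X) (g : int).
Hypothesis rg : riemann g.

Lemma hv0 P : hv P 0 0.
Proof. by have := hv_cst pl P 0; rewrite rmorph0. Qed.

Lemma hv1 P : hv P 1 1.
Proof. by have := hv_cst pl P 1; rewrite rmorph1. Qed.

Lemma hvN P f c : hv P f c -> hv P (- f) (- c).
Proof.
move=> /(hvM pl (hv_cst pl P (- 1))); by rewrite rmorphN rmorph1 !mulN1r.
Qed.

Lemma hvX P f c (n : nat) : hv P f c -> hv P (f ^+ n) (c ^+ n).
Proof.
move=> fc; elim: n => [|n IH]; first by rewrite !expr0; apply: hv1.
by rewrite !exprS; apply: (hvM pl).
Qed.

Lemma hv_ev P f c (p : {poly k}) : hv P f c -> hv P (ev emb f p) p.[c].
Proof.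
move=> fc; elim/poly_ind: p => [|p a IH]; first by rewrite ev0 horner0; apply: hv0.
rewrite evD evM evC evX !hornerE; apply: (hvD pl); last exact: (hv_cst pl).
exact: (hvM pl).
Qed.

Lemma hv_neq0 P u c : hv P u c -> c != 0 -> u != 0.
Proof. by move=> uc; apply: contra_neq => u0; apply: (hv_inj pl uc); rewrite u0; apply: hv0. Qed.

Lemma not_dim_ge_zero V : (forall f, V f -> f = 0) -> ~ dim_ge emb V 1.
Proof.
move=> V0 [b [Vb ib]]; have := ib (fun=> 1).
by rewrite big_ord1 (V0 _ (Vb _)) mulr0 => /(_ erefl ord0)/eqP; rewrite oner_eq0.
Qed.

Lemma dim_ge2 V : dim_ge emb V 2 -> exists2 f, V f & ~ constant emb f.
Proof.
move=> V2; apply: contrapT => nV; apply: (@not_dim_ge_zero (fun f => f = 0)) => //.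
apply: dim_ge_codim1 V2 => [|f h Vf Vh nf].
  by split=> // c f h -> ->; rewrite mulr0 addr0.
have cst e : V e -> constant emb e.
  by move=> Ve; apply: contrapT => ne; apply: nV; exists e.
have [c fc] := cst f Vf; have [e he] := cst h Vh.
have c0 : c != 0 by apply/eqP=> c0; apply: nf; rewrite fc c0 rmorph0.
by exists (e / c); rewrite fc he -rmorphM divfK ?subrr.
Qed.

(* Without a uniformizer at P every L(D) would vanish. *)
Lemma unif_exists P : exists pi, unif P pi.
Proof.
apply: contrapT => nu; pose D := << g *g P>>.
have D0 f : rr D f -> f = 0.
  move=> [//|/(_ P)[n [[pi [u [c [upi _ _ _]]]] _]]]; by case: nu; exists pi.
have : dim_eq emb (rr D) 0 by split; [apply: dim_ge0|apply: not_dim_ge_zero].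
suff /(riemann_le rg) H : subspace emb (rr D) by move/H; rewrite degU; lia.
by split=> [|c f h /D0-> /D0->]; [|rewrite mulr0 addr0]; left.
Qed.

Lemma nonconstant_exists : exists f, ~ constant emb f.
Proof.
apply: contrapT => /forallNP nc.
have cst f : constant emb f by apply: contrapT; apply: nc.
pose D := << (absz g).+1%:Z *g x0>>.
have D_all f : rr D f.
  have [c fc] := cst f; have [c0|c0] := eqVneq c 0.
    by left; rewrite fc c0 rmorph0.
  right=> P; exists 0; split; last by rewrite coeffU oppr_le0 mulr_ge0 ?ler0n.
  have [pi upi] := unif_exists P; exists pi, f, c; rewrite expr0z mulr1 fc.
  by split=> //; apply: (hv_cst pl).
have n2 : ~ dim_ge emb (rr D) 2 by move=> /dim_ge2 [f _]; apply.
have [r r1 /(riemann_le rg)] := dim_eq_ex n2.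
rewrite degU => H; have : subspace emb (rr D) by split.
by move/H; lia.
Qed.

Lemma unif_neq0 P pi : unif P pi -> pi != 0.
Proof.
move=> [_ upi]; apply/eqP=> pi0; have [f nf] := nonconstant_exists.
have cst h : regular P h -> constant emb h.
  move=> [c hc]; exists c; apply/eqP; rewrite -subr_eq0; apply/eqP.
  have : hv P (h - emb c) 0.
    by rewrite -(subrr c); apply: (hvD pl) => //; apply: hvN; apply: (hv_cst pl).
  by move=> /upi [? [? [_ ->]]]; rewrite pi0 mulr0.
have [h1 [h2 [/cst[c1 ->] /cst[c2 ->] fE]]] := hv_frac pl P f.
by apply: nf; exists (c1 / c2); rewrite fmorph_div.
Qed.

Definition pi P : F := projT1 (cid (unif_exists P)).

Lemma piP P : unif P (pi P).
Proof. exact: (projT2 (cid (unif_exists P))). Qed.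

Lemma pi_neq0 P : pi P != 0.
Proof. exact: unif_neq0 (piP P). Qed.

Definition pw P n f : Prop := exists h c, hv P h c /\ f = h * pi P ^ n.

Definition val P f n : Prop :=
  exists u c, [/\ hv P u c, c != 0 & f = u * pi P ^ n].

Lemma horder_val P f n : horder P f n <-> val P f n.
Proof.
split=> [[p [u [c [up uc c0 ->]]]]|[u [c [uc c0 ->]]]]; last first.
  by exists (pi P), u, c; split=> //; apply: piP.
have [w [e [we pE]]] := (piP P).2 _ up.1.
have [w' [e' [we' piE]]] := up.2 _ (piP P).1.
have ww' : w * w' = 1.
  by apply: (mulIf (unif_neq0 up)); rewrite mul1r -mulrA -piE -pE.
have e0 : e != 0.
  apply/eqP=> e0; have := hv_inj pl (hvM pl we we'); rewrite ww' => /(_ _ (hv1 P)).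
  by rewrite e0 mul0r => /eqP; rewrite eq_sym oner_eq0.
have wn : hv P (w ^ n) (e ^ n).
  case: n => n; first exact: hvX.
  rewrite !NegzE -!exprnN; apply: (hvV pl); [exact: hvX|exact: expf_neq0].
exists (u * w ^ n), (c * e ^ n); split; first exact: (hvM pl).
  by rewrite mulf_neq0 // expfz_neq0.
by rewrite pE expfzMl mulrA.
Qed.

Lemma hv_pi P : hv P (pi P) 0.
Proof. exact: (piP P).1. Qed.

Lemma pw_le P n m f : (m <= n)%R -> pw P n f -> pw P m f.
Proof.
move=> mn [h [c [hc ->]]]; have -> : n = (`|n - m|%N)%:Z + m by lia.
exists (h * pi P ^+ `|n - m|%N), (c * 0 ^+ `|n - m|%N); split.
  by apply: (hvM pl) => //; apply: hvX; apply: hv_pi.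
by rewrite expfzDr ?pi_neq0 // mulrA.
Qed.

Lemma pw0 P n : pw P n 0.
Proof. by exists 0, 0; split; rewrite ?mul0r //; apply: hv0. Qed.

Lemma pwD P n f h : pw P n f -> pw P n h -> pw P n (f + h).
Proof.
move=> [f' [c [fc ->]]] [h' [d [hd ->]]]; exists (f' + h'), (c + d).
by split; [apply: (hvD pl)|rewrite mulrDl].
Qed.

Lemma pwM P n m f h : pw P n f -> pw P m h -> pw P (n + m) (f * h).
Proof.
move=> [f' [c [fc ->]]] [h' [d [hd ->]]]; exists (f' * h'), (c * d).
by split; [apply: (hvM pl)|rewrite expfzDr ?pi_neq0 // mulrACA].
Qed.

Lemma regular_pw P f : regular P f <-> pw P 0 f.
Proof.
split=> [[c fc]|[h [c [hc ->]]]]; first by exists f, c; rewrite expr0z mulr1.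
by exists c; rewrite expr0z mulr1.
Qed.

Lemma pwZ P n c f : pw P n f -> pw P n (emb c * f).
Proof.
move=> fn; rewrite -[n]add0r; apply: pwM => //; apply/regular_pw.
by exists c; apply: (hv_cst pl).
Qed.

Lemma pwN P n f : pw P n f -> pw P n (- f).
Proof. by move=> /(pwZ (-1)); rewrite rmorphN rmorph1 mulN1r. Qed.

Lemma pw_sum P n (I : Type) (r : seq I) (f : I -> F) :
  (forall i, pw P n (f i)) -> pw P n (\sum_(i <- r) f i).
Proof. by move=> fn; elim/big_rec: _ => [|i h _]; [apply: pw0|apply: pwD]. Qed.

Lemma pw_subspace P n : subspace emb (pw P n).
Proof. by split=> [|c f h fn hn]; [apply: pw0|apply: pwD => //; apply: pwZ]. Qed.

Lemma val_pw P f n : val P f n -> pw P n f.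
Proof. by move=> [u [c [uc _ ->]]]; exists u, c. Qed.

Lemma val_neq0 P f n : val P f n -> f != 0.
Proof.
move=> [u [c [uc c0 ->]]]; rewrite mulf_neq0 ?expfz_neq0 ?pi_neq0 //.
exact: hv_neq0 uc c0.
Qed.

Lemma val_npw P f n : val P f n -> ~ pw P (n + 1) f.
Proof.
move=> [u [c [uc c0 ->]]] [h [d [hd]]]; rewrite [n + 1]addrC expfzDr ?pi_neq0 // expr1z.
rewrite mulrA => /(mulIf (expfz_neq0 _ (pi_neq0 P))) uE.
move: c0; rewrite (_ : c = 0) ?eqxx //; apply: (hv_inj pl uc).
by rewrite uE -(mulr0 d); apply: (hvM pl) => //; apply: hv_pi.
Qed.

Lemma pw_val P f n : pw P n f -> pw P (n + 1) f \/ val P f n.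
Proof.
move=> [h [c [hc ->]]]; have [c0|c0] := eqVneq c 0; last by right; exists h, c.
rewrite c0 in hc; have [h' [d [hd ->]]] := (piP P).2 _ hc; left; exists h', d; split=> //.
by rewrite [n + 1]addrC expfzDr ?pi_neq0 // expr1z mulrA.
Qed.

Lemma val_le P f n m : val P f n -> pw P m f -> m <= n.
Proof.
move=> fn fm; rewrite leNgt; apply/negP=> nm; apply: (val_npw fn).
by apply: pw_le fm; lia.
Qed.

Lemma val_uniq P f n m : val P f n -> val P f m -> n = m.
Proof.
move=> fn fm; apply: le_anti; apply/andP; split.
  exact: val_le fm (val_pw fn).
exact: val_le fn (val_pw fm).
Qed.

Lemma valM P f h n m : val P f n -> val P h m -> val P (f * h) (n + m).
Proof.
move=> [u [c [uc c0 ->]]] [w [d [wd d0 ->]]]; exists (u * w), (c * d); split.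
- exact: (hvM pl).
- exact: mulf_neq0.
- by rewrite expfzDr ?pi_neq0 // mulrACA.
Qed.

Lemma valV P f n : val P f n -> val P f^-1 (- n).
Proof.
move=> [u [c [uc c0 ->]]]; exists u^-1, c^-1; split; first exact: (hvV pl).
  by rewrite invr_eq0.
by rewrite invfM invr_expz.
Qed.

Lemma val_unit P u c : hv P u c -> c != 0 -> val P u 0.
Proof. by move=> uc c0; exists u, c; rewrite expr0z mulr1. Qed.

Lemma val_cst P c : c != 0 -> val P (emb c) 0.
Proof. by move=> c0; apply: val_unit c0; apply: (hv_cst pl). Qed.

Lemma val_pi P : val P (pi P) 1.
Proof. by exists 1, 1; rewrite oner_eq0 expr1z mul1r; split=> //; apply: hv1. Qed.

Lemma valX P f n (m : nat) : val P f n -> val P (f ^+ m) (n * m%:Z).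
Proof.
move=> fn; elim: m => [|m IH].
  by rewrite expr0 mulr0; apply: val_unit (hv1 P) _; rewrite oner_eq0.
by rewrite exprS intS mulrDr mulr1; apply: valM.
Qed.

Definition deep P f : Prop := forall n : nat, pw P n%:Z f.

Lemma deep_val P f n : deep P f -> ~ val P f n.
Proof. by move=> /(_ `|n|.+1%N) fn /val_le /(_ fn); lia. Qed.

Lemma deepM P f h : deep P f -> regular P h -> deep P (f * h).
Proof. by move=> df /regular_pw rh n; rewrite -[n%:Z]addr0; apply: pwM. Qed.

Lemma regular_deep P f : regular P f -> deep P f \/ exists n, val P f n.
Proof.
move=> /regular_pw rf; have [|/existsNP [n]] := EM (deep P f); first by left.
elim: n => [//|n IH] nf; have [fn|//] := EM (pw P n f).
have [|v] := pw_val fn; last by right; exists n.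
by move=> fS; case: nf; rewrite -addn1 PoszD.
Qed.

Lemma deep_expr P f (m : nat) : regular P f -> deep P (f ^+ m) -> deep P f.
Proof.
move=> rf dfm; have [//|[n /(valX m) v]] := regular_deep rf.
by case: (deep_val dfm v).
Qed.

Lemma regular_ev P f (p : {poly k}) : regular P f -> regular P (ev emb f p).
Proof. by move=> [c fc]; exists p.[c]; apply: hv_ev. Qed.

Lemma regular_algebraic P f (R : {poly F}) : deep P f -> R.[f] = 0 ->
  (forall i, regular P R`_i) -> deep P R`_0.
Proof.
move=> df; rewrite (@horner_coef_wide _ (size R).+1) // big_ord_recl expr0 mulr1.
move=> /eqP; rewrite addr_eq0 => /eqP -> rR n; apply/pwN/pw_sum => i.
rewrite lift0 exprS mulrCA; move: n; apply: deepM => //.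
apply/regular_pw; rewrite -(addr0 0); apply: pwM; first exact/regular_pw.
apply/regular_pw; have /(_ 0) /regular_pw [c fc] := df.
by exists (c ^+ i); apply: hvX.
Qed.

Lemma val_ev_pi P (p : {poly k}) : p != 0 -> exists n, val P (ev emb (pi P) p) n.
Proof.
move=> p0; have [m [q]] := multiplicity_XsubC p 0; rewrite p0 /= => q0 ->.
exists (0 + 1 * m%:Z); rewrite evM; apply: valM.
  by apply: val_unit (hv_ev q (hv_pi P)) _.
by rewrite polyC0 subr0 evXn; apply: valX; apply: val_pi.
Qed.

Section Deep.
Variables (d : nat) (t : F).
Hypothesis dt : dep emb d t.

Lemma dep_nonconstant : ~ constant emb t.
Proof.
move=> [a tE]; have [f nf] := nonconstant_exists.
have [Q [Q0 Qf /choice[p pE]]] := dep_algebraic f dt.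
have evE i : ev emb t (p i) = emb (p i).[a].
  by rewrite /ev tE horner_map.
have QE : Q = map_poly emb (\poly_(i < size Q) (p i).[a]).
  apply/polyP=> i; rewrite coef_map coef_poly /=; case: ltnP => si; last first.
    by rewrite rmorph0 nth_default.
  by rewrite pE evE.
have := @ev_eq0 _ _ emb f (\poly_(i < size Q) (p i).[a]) nf.
rewrite /ev -QE Qf => /(_ erefl) p0; case/eqP: Q0; rewrite QE p0.
exact: rmorph0.
Qed.

(* A nonzero f in all powers of the maximal ideal would put t - a there, and
   then a relation between the powers of a uniformizer would hold over the residue field. *)
Lemma deep_regular_eq0 P f : regular P t -> deep P f -> f = 0.
Proof.
move=> [a ta] df; apply/eqP/negPn/negP=> f0.
have nt := dep_nonconstant.
have sE : ev emb t ('X - a%:P) = t - emb a by rewrite evD evN evX evC.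
have hs : hv P (t - emb a) 0.
  by rewrite -(subrr a); apply: (hvD pl) => //; apply: hvN; apply: (hv_cst pl).
have ds : deep P (t - emb a).
  have [Q [Q0 Qf Qc]] := dep_algebraic f dt.
  have [R [R0 Rf [j RE]]] := poly_strip_X Q0 f0 Qf.
  have rR i : regular P R`_i.
    by rewrite RE; have [p ->] := Qc (i + j)%N; apply: regular_ev; exists a.
  have := regular_algebraic df Rf rR; move: R0; rewrite (RE 0%N).
  have [p ->] := Qc (0 + j)%N => p0; have {}p0 : p != 0.
    by apply: contra_neq p0 => ->; rewrite ev0.
  have [m [q]] := multiplicity_XsubC p a; rewrite p0 /= => qa ->.
  have hq := hv_ev q ta; rewrite evM => dp.
  have evX : ev emb t (('X - a%:P) ^+ m) = (t - emb a) ^+ m.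
    by rewrite /ev rmorphXn /= horner_exp -/(ev _ _ _) sE.
  apply: (@deep_expr _ _ m); first by exists 0.
  rewrite -evX -[X in deep P X](mulKf (hv_neq0 hq qa)) mulrC.
  by apply: deepM => //; exists (q.[a])^-1; apply: (hvV pl).
have [q [[i0 qi0] sq]] := dep_nonvanishing a (fun i => pi P ^+ i) dt nt.
pose p := \poly_(i < d.+1) (q (inord i)).[a].
have p0 : p != 0.
  apply: contra_neq qi0 => /(congr1 (fun p : {poly k} => p`_i0)).
  by rewrite coef_poly ltn_ord inord_val coef0.
have [n] := val_ev_pi P p0; apply: deep_val.
have /choice [r rE] : forall i, exists r, q i = (q i).[a]%:P + r * ('X - a%:P).
  move=> i; have /factor_theorem [r rE] : root (q i - (q i).[a]%:P) a.
    by rewrite /root !hornerE subrr.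
  by exists r; rewrite -rE addrC subrK.
have -> : ev emb (pi P) p = (t - emb a) * (- \sum_i ev emb t (r i) * pi P ^+ i).
  apply/eqP; rewrite mulrN -addr_eq0; apply/eqP; rewrite -[RHS]sq mulr_sumr.
  rewrite (@ev_coef _ _ _ _ p d.+1) ?size_poly // -big_split /=; apply: eq_bigr => i _.
  rewrite [in RHS](rE i) coef_poly ltn_ord inord_val evD evC evM sE; ring.
apply: deepM => //; apply/regular_pw/pwN/pw_sum => i; rewrite -[0]addr0.
apply: pwM; apply/regular_pw; first by apply: regular_ev; exists a.
by exists (0 ^+ i); apply/hvX/hv_pi.
Qed.

End Deep.

Variables (d : nat) (t : F).
Hypotheses (dt : dep emb d t) (t_place : forall P, regular P t \/ hv P t^-1 0).

Lemma val_exists P f : f != 0 -> exists n, val P f n.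
Proof.
suff reg h : regular P h -> h != 0 -> exists n, val P h n.
  have [h1 [h2 [r1 r2 ->]]] := hv_frac pl P f.
  rewrite mulf_eq0 invr_eq0 negb_or => /andP[n1 n2].
  have [n v1] := reg _ r1 n1; have [m v2] := reg _ r2 n2.
  by exists (n - m); apply: valM => //; apply: valV.
move=> rh h0; have [dh|//] := regular_deep rh; case/eqP: h0.
have [rt|rt] := t_place P; first exact: deep_regular_eq0 dt _ _ rt dh.
have t0 : t != 0 by apply/eqP=> t0; case: (dep_nonconstant dt); exists 0; rewrite rmorph0.
by apply: deep_regular_eq0 (depV dt t0) _ _ _ dh; exists 0.
Qed.

Definition lspace D f : Prop := forall P, pw P (- coeff P D) f.

Lemma rr_lspace D f : rr D f <-> lspace D f.
Proof.
split=> [[-> P|h P]|h]; first exact: pw0.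
  by have [n [/horder_val /val_pw v le]] := h P; apply: pw_le v.
have [->|f0] := eqVneq f 0; [by left|right=> P].
have [n v] := val_exists P f0; exists n; split; first exact/horder_val.
exact: val_le v (h P).
Qed.

Lemma rr_lspaceE : rr = lspace.
Proof. by apply: funext => D; apply: funext => f; apply/propext/rr_lspace. Qed.

Lemma lspace_subspace D : subspace emb (lspace D).
Proof.
split=> [P|c f h fD hD P]; first exact: pw0.
exact: (pw_subspace P _).2.
Qed.

Lemma lspace_riemann D r : dim_eq emb (lspace D) r -> deg D + 1 - r%:Z <= g.
Proof.
by rewrite -rr_lspaceE; apply: (riemann_le rg); rewrite rr_lspaceE; apply: lspace_subspace.
Qed.

Lemma lspace_le D D' f : (forall P, (coeff P D : int) <= coeff P D') ->
  lspace D f -> lspace D' f.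
Proof. by move=> DD' fD P; apply: pw_le (fD P); rewrite lerN2. Qed.

Lemma lspaceM D D' f h : lspace D f -> lspace D' h -> lspace (D + D') (f * h).
Proof. by move=> fD hD P; rewrite coeffD opprD; apply: pwM. Qed.

Lemma pw_codim1 P n f h : pw P n f -> pw P n h -> ~ pw P (n + 1) f ->
  exists c, pw P (n + 1) (h - emb c * f).
Proof.
move=> /pw_val [//|[u [c [uc c0 ->]]]] [v [e [ve ->]]] _; exists (e / c).
have /((piP P).2 _) [w [e' [we' wE]]] : hv P (v - emb (e / c) * u) 0.
  have -> : 0 = e - e / c * c by rewrite divfK ?subrr.
  apply: (hvD pl) => //; apply: hvN.
  by apply: (hvM pl) => //; apply: (hv_cst pl).
exists w, e'; split=> //.
by rewrite mulrA -mulrBl wE [n + 1]addrC expfzDr ?pi_neq0 // expr1z mulrA.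
Qed.

Definition sdiv (s : seq X) : {freeg X / int} := \sum_(P <- s) <<P>>.

Lemma sdiv_nil : sdiv [::] = 0.
Proof. exact: big_nil. Qed.

Lemma sdiv_cons P s : sdiv (P :: s) = <<P>> + sdiv s.
Proof. exact: big_cons. Qed.

Lemma sdiv_cat s s' : sdiv (s ++ s') = sdiv s + sdiv s'.
Proof. exact: big_cat. Qed.

Lemma coeff_sdiv_cons P s Q : (coeff Q (sdiv (P :: s)) : int) = (P == Q)%:Z + coeff Q (sdiv s).
Proof. by rewrite sdiv_cons coeffD coeffU mul1r natz. Qed.

Lemma sdiv_ge0 s P : (0 : int) <= coeff P (sdiv s).
Proof.
elim: s => [|Q s IH]; first by rewrite sdiv_nil coeff0.
by rewrite coeff_sdiv_cons addr_ge0.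
Qed.

Lemma lspace_step D P r : dim_ge emb (lspace (D + <<P>>)) r.+1 ->
  dim_ge emb (lspace D) r.
Proof.
apply: dim_ge_codim1; first exact: lspace_subspace.
have cP : - coeff P (D + <<P>>) + 1 = - coeff P D.
  by rewrite coeffD coeffU eqxx mulr1 opprD subrK.
have off Q f : Q != P -> lspace (D + <<P>>) f -> pw Q (- coeff Q D) f.
  by move=> QP /(_ Q); rewrite coeffD coeffU eq_sym (negbTE QP) mulr0 addr0.
move=> f h fD hD nf.
have nfP : ~ pw P (- coeff P D) f.
  by move=> fP; apply: nf => Q; have [->|QP] := eqVneq Q P; last exact: off.
have := pw_codim1 (fD P) (hD P); rewrite cP => /(_ nfP) [c hc]; exists c => Q.
have [->//|QP] := eqVneq Q P; apply: off => //.
rewrite (_ : _ - _ = emb (- c) * f + h); last by rewrite rmorphN mulNr addrC.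
exact: (lspace_subspace _).2.
Qed.

Lemma effective_seq D : (forall P, (0 : int) <= coeff P D) ->
  exists s : seq X, D = sdiv s.
Proof.
move=> D0; exists (flatten [seq nseq `|coeff z D|%N z | z <- dom D]).
rewrite /sdiv big_flatten /= big_map -[LHS]freeg_sumE; apply: eq_bigr => z _.
rewrite big_nseq iter_addr_0 freegU_muln; congr << _ *g z >>.
by have := D0 z; rewrite natz; lia.
Qed.

Lemma deg_seq (s : seq X) : deg (sdiv s) = (size s)%:Z.
Proof.
elim: s => [|P s IH]; first by rewrite sdiv_nil deg0.
by rewrite sdiv_cons degD degU IH /= -add1n PoszD.
Qed.

Lemma lspace_steps D (s : seq X) (m : nat) :
  dim_ge emb (lspace (D + sdiv s)) (m + size s) -> dim_ge emb (lspace D) m.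
Proof.
elim: s => [|P s IH] /=; first by rewrite sdiv_nil addr0 addn0.
by rewrite sdiv_cons addnS [<<P>> + _]addrC addrA => /lspace_step /IH.
Qed.

Lemma effective_diff D D' : (forall P, (coeff P D : int) <= coeff P D') ->
  exists s : seq X, D' = D + sdiv s.
Proof.
move=> DD'; have [P|s sE] := @effective_seq (D' - D); first by rewrite coeffB subr_ge0.
by exists s; rewrite -sE addrC subrK.
Qed.

Lemma lspace_finite D : exists N, ~ dim_ge emb (lspace D) N.
Proof.
have [D0 [r0 []]] := riemann_eq rg; rewrite rr_lspaceE => -[_ nD0] _.
have [P|s sE] := @effective_seq (fgpos (D - D0)); first by rewrite coeff_fgposE le_max lexx.
exists (r0.+1 + size s)%N => h; apply: nD0; apply: (@lspace_steps _ s).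
apply: dim_ge_sub h => f; apply: lspace_le => P.
by rewrite -sE coeffD coeff_fgposE coeffB -lerBlDl le_max lexx orbT.
Qed.

Lemma dim_exists D : exists r, dim_eq emb (lspace D) r.
Proof.
have [N nN] := lspace_finite D.
have [|r _ dr] := @dim_eq_ex _ _ emb (lspace D) N; last by exists r.
by move=> /(dim_ge_le (leqnSn N)).
Qed.

Lemma dim_eq_max (V : F -> Prop) r s : dim_eq emb V r -> dim_ge emb V s -> (s <= r)%N.
Proof. by move=> [_ nV] Vs; rewrite leqNgt; apply/negP=> /dim_ge_le /(_ Vs). Qed.

Lemma lspace_ge D : exists2 r, dim_ge emb (lspace D) r & deg D + 1 - g <= r%:Z.
Proof.
have [r dr] := dim_exists D; exists r; first exact: dr.1.
by have := lspace_riemann dr; lia.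
Qed.

Lemma dim_mono D D' r r' : (forall P, (coeff P D : int) <= coeff P D') ->
  dim_eq emb (lspace D) r -> dim_eq emb (lspace D') r' -> r'%:Z <= r%:Z + deg (D' - D).
Proof.
move=> /effective_diff [s ->] dr dr'; rewrite addrAC subrr add0r deg_seq.
have [|rr'] := leqP (size s) r'; last by lia.
move=> /subnK rE; have := dr'.1; rewrite -rE => /lspace_steps /(dim_eq_max dr); lia.
Qed.

Lemma poly_of_fun (n : nat) (c : 'I_n -> k) : exists p : {poly k},
  (forall i : 'I_n, p`_i = c i) /\ forall x, ev emb x p = \sum_i emb (c i) * x ^+ i.
Proof.
pose p := \poly_(i < n) (if insub i is Some j then c j else 0).
have pE (i : 'I_n) : p`_i = c i by rewrite coef_poly ltn_ord valK.
exists p; split=> // x; rewrite (@ev_coef _ _ _ _ p n) ?size_poly //.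
by apply: eq_bigr => i _; rewrite pE.
Qed.

Lemma powers_indep f h (n : nat) : ~ constant emb f -> h != 0 ->
  lin_indep emb (fun i : 'I_n => f ^+ i * h).
Proof.
move=> nf h0 c; under eq_bigr do rewrite mulrA.
rewrite -mulr_suml => /eqP; rewrite mulf_eq0 (negbTE h0) orbF => /eqP sum0.
have [p [pE pev]] := poly_of_fun c.
have /(ev_eq0 nf) p0 : ev emb f p = 0 by rewrite pev.
by move=> i; rewrite -pE p0 coef0.
Qed.

Lemma dim_ge1 V : dim_ge emb V 1 -> exists2 f, V f & f != 0.
Proof.
move=> V1; apply: contrapT => nV; apply: (@not_dim_ge_zero V) => // f Vf.
by apply/eqP/negPn/negP=> f0; apply: nV; exists f.
Qed.

(* Powers of a nonconstant f without poles would make some L(D) infinite dimensional. *)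
Lemma lspace0 f : lspace 0 f -> constant emb f.
Proof.
move=> f0; apply: contrapT => nf; pose D := << g *g x0 >>.
have [r Dr rge] := lspace_ge D.
have /(dim_ge_le (s := 1)) /(_ Dr) /dim_ge1 [h Dh h0] : (0 < r)%N.
  by move: rge; rewrite degU; lia.
have [N] := lspace_finite D; apply; exists (fun i : 'I_N => f ^+ i * h).
split; last exact: powers_indep.
move=> i; elim: (i : nat) => [|n IH]; first by rewrite expr0 mul1r.
by rewrite exprS -mulrA -[D]add0r; apply: lspaceM.
Qed.

Definition finpoles f : Prop := exists s : seq X, forall P, P \notin s -> pw P 0 f.

Lemma finpoles_cst c : finpoles (emb c).
Proof. by exists [::] => P _; apply/regular_pw; exists c; apply: (hv_cst pl). Qed.

Lemma finpoles_ev f (p : {poly k}) : finpoles f -> finpoles (ev emb f p).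
Proof.
by move=> [s fs]; exists s => P /fs /regular_pw rf; apply/regular_pw/regular_ev.
Qed.

Lemma coeff_sum_uniq (s : seq X) (n : X -> int) P : uniq s ->
  coeff P (\sum_(Q <- s) << n Q *g Q >>) = if P \in s then n P else 0.
Proof.
move=> us; rewrite raddf_sum /=; case: ifPn => Ps.
  rewrite (bigD1_seq P) //= coeffU eqxx mulr1 big1 ?addr0 // => Q QP.
  by rewrite coeffU (negbTE QP) mulr0.
rewrite big_seq big1 // => Q Qs; rewrite coeffU.
by case: eqP Qs Ps => [->->//|]; rewrite mulr0.
Qed.

Lemma val_cases P f : f != 0 -> pw P 0 f \/ pw P 1 f^-1.
Proof.
move=> /(val_exists P) [n v]; have [n0|n0] := leP 0 n; [left|right].
  by apply: pw_le (val_pw v).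
by apply: pw_le (val_pw (valV v)); lia.
Qed.

Lemma finite_or_large (Q : X -> Prop) :
  (exists s : seq X, forall P, Q P -> P \in s) \/
  forall n : nat, exists s : seq X, [/\ uniq s, size s = n & forall P, P \in s -> Q P].
Proof.
have [|nfin] := EM (exists s : seq X, forall P, Q P -> P \in s); [by left|right].
elim=> [|n [s [us sz sQ]]]; first by exists [::].
have [P [QP Ps]] : exists P, Q P /\ P \notin s.
  apply: contrapT => nP; apply: nfin; exists s => P QP.
  by apply/negPn/negP=> Ps; apply: nP; exists P.
exists (P :: s); split=> [|/=|R]; rewrite ?sz //= ?Ps //.
by rewrite inE => /predU1P[->|/sQ].
Qed.

Lemma finpolesV f : finpoles f -> f != 0 -> finpoles f^-1.
Proof.
move=> [s fs] f0.
have /choice [n nP] : forall P, exists n : int, pw P (- n) f /\ (pw P 0 f -> n = 0).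
  move=> P; have [fP|nfP] := EM (pw P 0 f); first by exists 0; rewrite oppr0.
  have [n v] := val_exists P f0; exists (- n); rewrite opprK; split=> //.
  exact: val_pw.
pose D := \sum_(P <- undup s) << n P *g P >>.
have cD P : coeff P D = if P \in s then n P else 0.
  by rewrite coeff_sum_uniq ?undup_uniq // mem_undup.
have fD P : pw P (- coeff P D) f.
  by rewrite cD; case: ifPn => [_|/fs]; [have [] := nP P|rewrite oppr0].
have D0 P : pw P 1 f -> coeff P D = 0.
  by move=> f1; rewrite cD; case: ifP => // _; apply: (nP P).2; apply: pw_le f1.
have [[s' s'P]|large] := finite_or_large (fun P => ~ pw P 0 f^-1).
  by exists s' => P Ps'; apply: contrapT => /s'P; rewrite (negbTE Ps').
have [N nN] := lspace_finite D; have [s' [us' sz s'P]] := large (absz (N%:Z + g)); exfalso.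
pose E := sdiv s'.
have cE P : coeff P E = if P \in s' then 1 else 0 by rewrite coeff_sum_uniq.
have [r Er rge] := lspace_ge E; apply: nN; apply: (@dim_ge_le _ _ _ _ r).
  by move: rge; rewrite deg_seq sz; lia.
apply: (dim_ge_scale f0 _ Er) => h hE P.
have [Ps'|Ps'] := boolP (P \in s'); last first.
  rewrite -[- _]addr0; apply: pwM => //.
  by have := hE P; rewrite cE (negbTE Ps') oppr0.
have f1 : pw P 1 f.
  have := s'P _ Ps'; have := @val_cases P f^-1; rewrite invr_eq0 invrK => /(_ f0).
  by case.
by rewrite D0 // oppr0 -(subrr 1); apply: pwM => //; have := hE P; rewrite cE Ps'.
Qed.

Lemma finpoles_algebraic (Q : {poly F}) h : Q != 0 -> Q.[h] = 0 ->
  (forall i, finpoles Q`_i) -> finpoles h.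
Proof.
move=> Q0 Qh /[dup] fQ /choice[s sP].
have l0 : lead_coef Q != 0 by rewrite lead_coef_eq0.
have [s' s'P] := finpolesV (fQ (size Q).-1) l0.
exists (s' ++ flatten [seq s i | i <- iota 0 (size Q)]) => P.
rewrite mem_cat negb_or => /andP[/s'P lP nP].
have QP i : pw P 0 Q`_i.
  have [iQ|Qi] := ltnP i (size Q); last by rewrite nth_default //; apply: pw0.
  apply: sP; apply: contra nP => Pi; apply/flattenP; exists (s i) => //.
  by apply: map_f; rewrite mem_iota.
have [->|h0] := eqVneq h 0; first exact: pw0.
have [//|hV] := val_cases P h0.
have [m mE] : exists m : nat, size Q = m.+1.
  by case: (size Q) (size_poly_eq0 Q) => [|m]; [rewrite (negbTE Q0)|exists m].
have lE : lead_coef Q = - \sum_(i < m) Q`_i * h^-1 ^+ (m - i).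
  apply/eqP; rewrite -addr_eq0 addrC; apply/eqP.
  transitivity (h^-1 ^+ m * Q.[h]); last by rewrite Qh mulr0.
  rewrite horner_coef mE big_ord_recr /= mulrDr mulr_sumr.
  congr (_ + _); last first.
    by rewrite lead_coefE mE mulrCA -exprMn mulVf // expr1n mulr1.
  apply: eq_bigr => i _; rewrite mulrCA.
  have -> : h^-1 ^+ m = h^-1 ^+ (m - i) * h^-1 ^+ i by rewrite -exprD subnK // ltnW.
  by rewrite -mulrA -[_ ^+ i * _]exprMn mulVf // expr1n mulr1.
have : pw P (1 + 0) (lead_coef Q * (lead_coef Q)^-1).
  apply: pwM lP; rewrite lE; apply/pwN/pw_sum => i.
  rewrite -(add0r (1 : int)); apply: pwM => //.
  rewrite -(subnSK (ltn_ord i)) exprS -(addr0 (1 : int)); apply: pwM => //.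
  apply/regular_pw; have /(pw_le (ler01)) /regular_pw [c hc] := hV.
  by exists (c ^+ (m - i.+1)); apply: hvX.
by rewrite mulfV // addr0 => /(val_le (val_unit (hv1 P) (oner_neq0 _))).
Qed.

Lemma lspace_finpoles D f : lspace D f -> finpoles f.
Proof. by move=> fD; exists (dom D) => P /coeff_outdom c0; have := fD P; rewrite c0 oppr0. Qed.

Lemma finpoles_all h : finpoles h.
Proof.
have [f ff nf] : exists2 f, finpoles f & ~ constant emb f.
  have [r Dr rge] := lspace_ge << g + 1 *g x0 >>.
  have /(dim_ge_le (s := 2)) /(_ Dr) /dim_ge2 [f /lspace_finpoles ff nf] : (1 < r)%N.
    by move: rge; rewrite degU; lia.
  by exists f.
have ft : finpoles t.
  have [Q [Q0 Qf /choice[p pE]]] := dep_algebraic f dt.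
  pose n := size Q; pose m := (\max_(i < n) size (p i))%N.
  have pm (i : 'I_n) : (size (p i) <= m)%N.
    exact: (@leq_bigmax _ (fun i : 'I_n => size (p i))).
  pose r j := \poly_(i < n) (p i)`_j.
  apply: (@finpoles_algebraic (\poly_(j < m) ev emb f (r j))).
  - have l0 : p n.-1 != 0.
      move: Q0; rewrite -lead_coef_eq0 lead_coefE pE; apply: contra_neq => ->.
      by rewrite ev0.
    have n0 : (n.-1 < n)%N by rewrite ltn_predL lt0n size_poly_eq0.
    have := lead_coef_eq0 (p n.-1); rewrite lead_coefE (negbTE l0) => /negbT pj.
    apply/eqP=> /(congr1 (fun T : {poly F} => T`_(size (p n.-1)).-1)).
    rewrite coef_poly coef0; case: ltnP => [_|].
      move/(ev_eq0 nf)/(congr1 (fun T : {poly k} => T`_n.-1)).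
      by rewrite coef_poly n0 coef0 => /eqP; rewrite (negbTE pj).
    have := pm (Ordinal n0); have := size_poly_eq0 (p n.-1); rewrite (negbTE l0) /=; lia.
  - rewrite horner_poly -[RHS]Qf horner_coef.
    under eq_bigr => j _ do rewrite (@ev_coef _ _ _ _ (r j) n) ?size_poly // mulr_suml.
    rewrite exchange_big /=; apply: eq_bigr => i _.
    rewrite pE (ev_coef _ _ (pm i)) mulr_suml; apply: eq_bigr => j _.
    by rewrite coef_poly ltn_ord mulrAC.
  - move=> j; rewrite coef_poly; case: ifP => _; first exact: finpoles_ev.
    by rewrite -[0](rmorph0 emb); apply: finpoles_cst.
have [Q [Q0 Qh /choice[p pE]]] := dep_algebraic h dt.
by apply: finpoles_algebraic Q0 Qh _ => i; rewrite pE; apply: finpoles_ev.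
Qed.

Definition isdiv f D : Prop := forall P, val P f (coeff P D).

Lemma isdiv_exists f : f != 0 -> exists D, isdiv f D.
Proof.
move=> f0; have /choice [n nP] : forall P, exists n, val P f n.
  by move=> P; apply: val_exists.
have [[s sP] [s' s'P]] := (finpoles_all f, finpoles_all f^-1).
exists (\sum_(P <- undup (s ++ s')) << n P *g P >>) => P.
rewrite coeff_sum_uniq ?undup_uniq // mem_undup mem_cat.
case: ifPn => // /norP[/sP f1 /s'P f2]; suff <- : n P = 0 by [].
apply: le_anti; rewrite (val_le (nP P) f1) andbT.
by have := val_le (valV (nP P)) f2; rewrite oppr_ge0.
Qed.

Lemma isdiv_neq0 f D : isdiv f D -> f != 0.
Proof. by move=> /(_ x0) /val_neq0. Qed.

Lemma isdivM f h D E : isdiv f D -> isdiv h E -> isdiv (f * h) (D + E).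
Proof. by move=> fD hE P; rewrite coeffD; apply: valM. Qed.

Lemma isdivV f D : isdiv f D -> isdiv f^-1 (- D).
Proof. by move=> fD P; rewrite coeffN; apply: valV. Qed.

Lemma isdiv_cst c : c != 0 -> isdiv (emb c) 0.
Proof. by move=> c0 P; rewrite coeff0; apply: val_cst. Qed.

Lemma isdivX f D (n : nat) : isdiv f D -> isdiv (f ^+ n) (D *+ n).
Proof. by move=> fD P; rewrite coeffMn -mulr_natr natz; apply: valX. Qed.

Lemma isdiv_lspace f D : isdiv f D -> lspace (- D) f.
Proof. by move=> fD P; rewrite coeffN opprK; apply: val_pw. Qed.

Lemma lspace_isdiv f D E h : isdiv f D -> lspace E h -> lspace (E - D) (f * h).
Proof. by move=> /isdiv_lspace fD hE; rewrite addrC; apply: lspaceM. Qed.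

Lemma isdiv_dim f D E r : isdiv f D -> dim_ge emb (lspace E) r ->
  dim_ge emb (lspace (E - D)) r.
Proof.
by move=> fD; apply: dim_ge_scale (isdiv_neq0 fD) _ => h; apply: lspace_isdiv.
Qed.

(* L(nD) is one-dimensional for all n, so deg (nD) stays bounded. *)
Lemma isdiv_deg f D : isdiv f D -> deg D = 0.
Proof.
suff deg_le h E : isdiv h E -> deg E <= 0.
  move=> fD; apply: le_anti; rewrite (deg_le _ _ fD) /=.
  by have := deg_le _ _ (isdivV fD); rewrite degN oppr_le0.
move=> hE; have hn := isdivX (absz g).+1 hE.
have n2 : ~ dim_ge emb (lspace (E *+ (absz g).+1)) 2.
  move=> /(isdiv_dim hn); rewrite subrr => /dim_ge2 [u /lspace0 cu nu].
  exact: nu.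
have [r r1 /lspace_riemann] := dim_eq_ex n2.
rewrite degMn -mulr_natr natz; nia.
Qed.

Lemma pw1_hv P f : pw P 1 f <-> hv P f 0.
Proof.
split=> [[h [c [hc ->]]]|/((piP P).2 _) [h [c [hc ->]]]].
  by rewrite expr1z -(mulr0 c); apply: (hvM pl) => //; apply: hv_pi.
by exists h, c; rewrite expr1z.
Qed.

Lemma hv_sub P f c : hv P f c <-> hv P (f - emb c) 0.
Proof.
split=> [fc|f0].
  by rewrite -(subrr c); apply: (hvD pl) => //; apply: hvN; apply: (hv_cst pl).
by rewrite -[f](subrK (emb c)) -[c in hv _ _ c]add0r; apply: (hvD pl) => //; apply: (hv_cst pl).
Qed.

Lemma nonconstant_neq f c : ~ constant emb f -> f - emb c != 0.
Proof. by move=> nf; rewrite subr_eq0; apply/eqP=> fc; apply: nf; exists c. Qed.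

Lemma effective_deg_gt0 D P : (forall Q, (0 : int) <= coeff Q D) ->
  (0 : int) < coeff P D -> 0 < deg D.
Proof.
move=> D0; have [[|Q s] ->] := effective_seq D0; last by rewrite deg_seq.
by rewrite sdiv_nil coeff0 ltxx.
Qed.

Section Fibres.
Variables (f : F) (Df : {freeg X / int}).
Hypotheses (nf : ~ constant emb f) (fDf : isdiv f Df).

Let E : {freeg X / int} := fgneg Df.

Lemma poles_ge0 P : (0 : int) <= coeff P E.
Proof. by rewrite coeff_fgnegE oppr_ge0 ge_min lexx. Qed.

Lemma poles_lspace : lspace E f.
Proof.
by move=> P; apply: pw_le (val_pw (fDf P)); rewrite coeff_fgnegE opprK ge_min lexx orbT.
Qed.

Lemma regular_poles P : regular P f <-> coeff P E = 0.
Proof.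
split=> [/regular_pw /(val_le (fDf P)) f0|]; first by rewrite coeff_fgnegE min_l ?oppr0.
by move=> c0; apply/regular_pw; have := poles_lspace P; rewrite c0 oppr0.
Qed.

Lemma val_pole P c : coeff P E != 0 -> val P (f - emb c) (- coeff P E).
Proof.
rewrite coeff_fgnegE opprK; have [|Dlt _] := leP 0 (coeff P Df); first by rewrite eqxx.
have cpw : pw P 0 (emb c) by apply/regular_pw; exists c; apply: (hv_cst pl).
have [fpw|//] : pw P (coeff P Df + 1) (f - emb c) \/ val P (f - emb c) (coeff P Df).
  apply: pw_val; apply: pwD; first exact: val_pw (fDf P).
  by apply: pw_le (pwN cpw); lia.
case: (val_npw (fDf P)); rewrite -[f](subrK (emb c)); apply: pwD => //.
by apply: pw_le cpw; lia.
Qed.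

Lemma fibre c : exists Z, [/\ forall P, (0 : int) <= coeff P Z, isdiv (f - emb c) (Z - E) &
  forall P, (0 : int) < coeff P Z <-> hv P f c].
Proof.
have [D fD] := isdiv_exists (nonconstant_neq c nf).
exists (D + E); split=> [P||P].
- rewrite coeffD; have [E0|E0] := eqVneq (coeff P E) 0.
    have /regular_poles [a fa] := E0; rewrite E0 addr0; apply: val_le (fD P) _.
    by apply/regular_pw; exists (a - c); apply: (hvD pl) => //; apply: hvN; apply: (hv_cst pl).
  by rewrite (val_uniq (fD P) (val_pole c E0)) addNr.
- by rewrite addrK.
rewrite coeffD; split=> [|fc].
  have [E0|E0] := eqVneq (coeff P E) 0; last first.
    by rewrite (val_uniq (fD P) (val_pole c E0)) addNr ltxx.
  rewrite E0 addr0 => D1; apply/hv_sub/pw1_hv; apply: pw_le (val_pw (fD P)); lia.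
have -> : coeff P E = 0 by apply/regular_poles; exists c.
by have /hv_sub /pw1_hv /(val_le (fD P)) := fc; rewrite addr0; lia.
Qed.

Lemma poles_deg_gt0 : 0 < deg E.
Proof.
have [P Pp] : exists P, (0 : int) < coeff P E.
  apply: contrapT => /forallNP nP; apply: nf; apply: lspace0 => P.
  rewrite coeff0 oppr0; apply/regular_pw/regular_poles; apply: le_anti.
  by rewrite poles_ge0 andbT leNgt; apply/negP.
exact: effective_deg_gt0 poles_ge0 Pp.
Qed.

Lemma fibre_deg Z c : isdiv (f - emb c) (Z - E) -> deg Z = deg E.
Proof. by move=> /isdiv_deg; rewrite degB => /eqP; rewrite subr_eq0 => /eqP. Qed.

Lemma fibre_point c : exists P, hv P f c.
Proof.
have [Z [Z0 fZ hZ]] := fibre c; have := poles_deg_gt0; rewrite -(fibre_deg fZ).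
have [[|P s] sE] := effective_seq Z0; first by rewrite sE sdiv_nil deg0 ltxx.
move=> _; exists P; apply/hZ; rewrite sE coeff_sdiv_cons eqxx.
by have := sdiv_ge0 s P; lia.
Qed.

Lemma dominated_by_poles (s : seq X) : exists (n : nat) A h,
  isdiv h A /\ forall P, (coeff P (sdiv s) : int) <= coeff P (E *+ n + A).
Proof.
elim: s => [|Q s [n [A [h [hA IH]]]]].
  exists 0%N, 0, (emb 1); split; first exact: isdiv_cst (oner_neq0 _).
  by move=> P; rewrite sdiv_nil mulr0n addr0.
have cE P : coeff P (E *+ n.+1) = coeff P (E *+ n) + coeff P E.
  by rewrite mulrSr coeffD.
have [E0|E0] := eqVneq (coeff Q E) 0.
  have /regular_poles [c fc] := E0; have [Z [Z0 fZ hZ]] := fibre c.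
  exists n.+1, (A + (Z - E)), (h * (f - emb c)); split; first exact: isdivM.
  move=> P; have := IH P; rewrite coeff_sdiv_cons !coeffD coeffN cE.
  have := Z0 P; case: eqP => [<- _|_] /=; last by lia.
  by have /hZ := fc; lia.
have EQ : (0 : int) < coeff Q E by rewrite lt_def E0 poles_ge0.
exists n.+1, A, h; split=> // P; have := IH P.
rewrite coeff_sdiv_cons !coeffD cE; have := poles_ge0 P.
by move: EQ; case: eqP => [<-|_] /=; lia.
Qed.

Lemma genus_bound (e : int) (N : nat) :
  (forall n : nat, (N <= n)%N -> exists2 r, dim_ge emb (lspace (E *+ n)) r &
     deg E * n%:Z + 1 - e <= r%:Z) -> g <= e.
Proof.
move=> big; have [D0 [r0 []]] := riemann_eq rg; rewrite rr_lspaceE => dr0 rE.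
have [P|s sE] := @effective_seq (fgpos D0); first by rewrite coeff_fgposE le_max lexx.
have [n [A [h [hA dom]]]] := dominated_by_poles s.
have [r Er rge] := big (n + N)%N (leq_addl _ _).
have [r' dr'] := dim_exists (E *+ (n + N) + A).
have := isdiv_dim (isdivV hA) Er; rewrite opprK => /(dim_eq_max dr') rr'.
have le P : (coeff P D0 : int) <= coeff P (E *+ (n + N) + A).
  apply: le_trans (_ : coeff P (E *+ n + A) <= _); last first.
    by rewrite mulrnDr !coeffD !coeffMn lerD2r lerDl mulrn_wge0 ?poles_ge0.
  by apply: le_trans (dom P); rewrite -sE coeff_fgposE le_max lexx orbT.
have := dim_mono le dr0 dr'.
rewrite degB degD (isdiv_deg hA) degMn addr0 -mulr_natr natz; lia.
Qed.

Lemma poles_powers (n i : nat) : (i <= n)%N -> lspace (E *+ n) (f ^+ i).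
Proof.
move=> le_in; apply: (@lspace_le (E *+ i)) => [P|].
  by rewrite !coeffMn -(subnK le_in) mulrnDr lerDr mulrn_wge0 ?poles_ge0.
elim: i {le_in} => [|i IH]; last first.
  by rewrite exprS mulrS; apply: lspaceM => //; apply: poles_lspace.
rewrite mulr0n expr0 => P.
by rewrite coeff0 oppr0; apply/regular_pw; exists 1; apply: hv1.
Qed.

Lemma poles_deg1 : deg E = 1 -> g <= 0.
Proof.
move=> E1; apply: (@genus_bound 0 0) => n _; exists n.+1; last by rewrite E1; lia.
exists (fun i => f ^+ i * 1); split; last by apply: powers_indep; rewrite // oner_neq0.
by move=> i; rewrite mulr1; apply: poles_powers; rewrite -ltnS.
Qed.

Lemma lspace_rational (n : nat) h (p q : {poly k}) : lspace (E *+ n) h -> q != 0 ->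
  ev emb f q * h = ev emb f p -> exists p', h = ev emb f p'.
Proof.
move=> hE; have [m] := ubnP (size q); elim: m q p => // m IH q p.
rewrite ltnS => sq q0 qh; have [s1|s1] := eqVneq (size q) 1.
  have /size_poly1P [c c0 qE] : size q == 1 by apply/eqP.
  exists (c^-1%:P * p); rewrite evM -qh qE !evC mulrA -rmorphM mulVf //.
  by rewrite rmorph1 mul1r.
have /closed_rootP [c qc] := s1.
have [P Pc] := fibre_point c.
have c0 : p.[c] = 0.
  apply: (hv_inj pl (hv_ev p Pc)); rewrite -qh.
  have [a ha] : regular P h.
    apply/regular_pw; have := hE P; have /regular_poles E0 : regular P f by exists c.
    by rewrite coeffMn E0 mul0rn oppr0.
  by have := hvM pl (hv_ev q Pc) ha; rewrite (rootP qc) mul0r.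
have /factor_theorem [q' q'E] := qc.
have /factor_theorem [p' p'E] : root p c by apply/rootP.
have fc := nonconstant_neq c nf.
have q'0 : q' != 0 by apply: contra_neq q0 => q'0; rewrite q'E q'0 mul0r.
apply: (IH q' p') => //.
  by move: sq; rewrite q'E size_Mmonic ?monicXsubC // size_XsubC addn2 /=.
apply: (mulIf fc); move: qh; rewrite q'E p'E !evM.
by rewrite evD evN evX evC => <-; rewrite mulrAC.
Qed.

Lemma lspace_poly_size (n : nat) (p : {poly k}) :
  lspace (E *+ n) (ev emb f p) -> (size p <= n.+1)%N.
Proof.
have [->|p0 fp] := eqVneq p 0; first by rewrite size_poly0.
have [P EP] : exists P, coeff P E != 0.
  apply: contrapT => /forallNP nP; apply: nf; apply: lspace0 => P; rewrite coeff0 oppr0.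
  by apply/regular_pw/regular_poles/eqP/negPn/negP.
have [r pE] := closed_field_poly_normal p.
have sr : size p = (size r).+1 by rewrite pE size_scale ?lead_coef_eq0 // size_prod_XsubC.
have : val P (ev emb f p) (0 + - coeff P E * (size r)%:Z).
  rewrite {1}pE -mul_polyC evM evC; apply: valM.
    by apply: val_cst; rewrite lead_coef_eq0.
  elim: r {pE sr} => [|c r IH].
    by rewrite big_nil mulr0 evC rmorph1; apply: val_unit (hv1 P) (oner_neq0 _).
  rewrite big_cons evM /= intS mulrDr mulr1; apply: valM => //.
  by rewrite evD evN evX evC; apply: val_pole.
move=> /val_le /(_ (fp P)); rewrite coeffMn -mulr_natr natz sr.
have := poles_ge0 P; move: EP; rewrite ltnS; nia.
Qed.

End Fibres.

Lemma nonspecial : exists D1, forall D r, (forall P, (coeff P D1 : int) <= coeff P D) ->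
  dim_eq emb (lspace D) r -> r%:Z = deg D + 1 - g.
Proof.
have [D1 [r1 []]] := riemann_eq rg; rewrite rr_lspaceE => dr1 rE; exists D1 => D r le dr.
by have := dim_mono le dr1 dr; have := lspace_riemann dr; rewrite degB; lia.
Qed.

Lemma flag_indep (V : nat -> F -> Prop) (z : nat -> F) (n : nat) (c : 'I_n -> k) :
  (forall j, subspace emb (V j)) -> (forall i j f, (i <= j)%N -> V i f -> V j f) ->
  (forall i : 'I_n, V i.+1 (z i) /\ ~ V i (z i)) ->
  V 0%N (\sum_i emb (c i) * z i) -> forall i, c i = 0.
Proof.
move=> sV mV; elim: n c => [c _ _ []//|n IH] c zV.
have Vsum j (i : nat) (e : 'I_i -> k) : (i <= j)%N -> (i <= n.+1)%N ->
    V j (\sum_(l < i) emb (e l) * z l).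
  move=> ij i_n; apply: (@subspace_sum _ _ emb (V j) i e (fun l => z l)) => // l.
  apply: (@mV l.+1); first exact: leq_trans (ltn_ord l) ij.
  exact: (zV (Ordinal (leq_trans (ltn_ord l) i_n))).1.
rewrite big_ord_recr /= => V0.
have cn : c ord_max = 0.
  apply/eqP/negPn/negP=> cn; apply: (zV ord_max).2 => /=.
  have [Vn0 VnD] := sV n.
  have Vs := Vsum n n (fun i => c (widen_ord (leqnSn n) i)) (leqnn n) (leqnSn n).
  have := VnD (-1) _ _ Vs (mV 0%N n _ (leq0n n) V0).
  rewrite rmorphN rmorph1 mulN1r addKr => /(VnD (c ord_max)^-1 _ 0) /(_ Vn0).
  by rewrite addr0 mulrA -rmorphM mulVf // rmorph1 mul1r.
move: V0; rewrite cn rmorph0 mul0r addr0 => /IH ci i.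
have {ci} ci : forall i, c (widen_ord (leqnSn n) i) = 0.
  by apply: ci => j; apply: (zV (widen_ord (leqnSn n) j)).
have [j ->|->] := unliftP ord_max i; last by [].
by rewrite -(ci j); congr (c _); apply: val_inj; rewrite /= /bump leqNgt ltn_ord.
Qed.

(* Functions z_i acquiring one pole of Z after the other are linearly independent over k(u):
   reducing a relation modulo u gives one over k. *)
Lemma zeros_deg_le u e Z : dep emb e u -> ~ constant emb u ->
  (forall P, (0 : int) <= coeff P Z) -> (forall P, (0 : int) < coeff P Z -> pw P (coeff P Z) u) ->
  deg Z <= e%:Z.
Proof.
move=> du nu Z0 Zu; have [s sE] := effective_seq Z0.
rewrite sE deg_seq lez_nat leqNgt; apply/negP=> es.
have [D1 D1P] := nonspecial.
pose W (i : nat) : {freeg X / int} := D1 + sdiv (take i s).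
have W1 i P : (coeff P D1 : int) <= coeff P (W i) by rewrite coeffD lerDl sdiv_ge0.
have WS i : (i < size s)%N -> W i.+1 = W i + << nth x0 s i >>.
  by move=> si; rewrite /W (take_nth x0) // -cats1 sdiv_cat sdiv_cons sdiv_nil addr0 addrA.
have Wle i j P : (i <= j)%N -> (coeff P (W i) : int) <= coeff P (W j).
  move=> /subnKC <-; rewrite /W takeD sdiv_cat addrA [X in _ <= X]coeffD lerDl.
  exact: sdiv_ge0.
have Wall i P : (coeff P (W i) : int) <= coeff P (D1 + Z).
  by rewrite /W sE -[in X in _ <= X](cat_take_drop i s) sdiv_cat addrA
    [X in _ <= X]coeffD lerDl sdiv_ge0.
have /choice [z zP] : forall i, exists z, (i < size s)%N ->
    lspace (W i.+1) z /\ ~ lspace (W i) z.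
  move=> i; have [si|] := ltnP i (size s); last by exists 0.
  apply: contrapT => /forallNP nz.
  have [r dr] := dim_exists (W i); have [r' dr'] := dim_exists (W i.+1).
  have := D1P _ _ (W1 i.+1) dr'; have := D1P _ _ (W1 i) dr.
  suff : (r' <= r)%N by rewrite WS // degD degU; lia.
  apply: dim_eq_max dr _; apply: dim_ge_sub dr'.1 => f fW.
  by apply: contrapT => nf; apply: (nz f).
have [q [[i0 qi0] sq]] := dep_nonvanishing 0 (fun i : 'I_e.+1 => z i) du nu.
have small (i : 'I_e.+1) : (i < size s)%N := leq_trans (ltn_ord i) es.
have zall (i : 'I_e.+1) : lspace (D1 + Z) (z i).
  by apply: lspace_le (zP i (small i)).1 => P; apply: Wall.
case/eqP: qi0.
apply: (@flag_indep (fun i => lspace (W i)) z e.+1 (fun i => (q i).[0])).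
- by move=> j; apply: lspace_subspace.
- by move=> i j f ij; apply: lspace_le => P; apply: Wle.
- by move=> i; apply: zP.
rewrite /W take0 sdiv_nil addr0 => P.
have [Zp|] := ltP 0 (coeff P Z); last first.
  move=> Zle; have -> : - coeff P D1 = - coeff P (D1 + Z).
    by rewrite coeffD (@le_anti _ _ (coeff P Z) 0) ?Zle ?Z0 // addr0.
  by apply: pw_sum => i; apply: pwZ; apply: zall.
have /choice [r rE] : forall i, exists r, q i = (q i).[0]%:P + r * 'X.
  move=> i; have /factor_theorem [r rE] : root (q i - (q i).[0]%:P) 0.
    by rewrite /root !hornerE subrr.
  by exists r; rewrite -['X]subr0 -polyC0 -rE addrC subrK.
have -> : \sum_i emb (q i).[0] * z i = u * (- \sum_i ev emb u (r i) * z i).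
  apply/eqP; rewrite mulrN -addr_eq0; apply/eqP; rewrite -[RHS]sq mulr_sumr.
  rewrite -big_split /=; apply: eq_bigr => i _.
  rewrite [in RHS](rE i) evD evC evM evX; ring.
have -> : - coeff P D1 = coeff P Z + (0 - coeff P (D1 + Z)) by rewrite coeffD; lia.
apply: pwM; first exact: Zu.
apply/pwN/pw_sum => i; apply: pwM; last exact: zall.
apply/regular_pw/regular_ev/regular_pw; apply: pw_le (Zu P Zp); lia.
Qed.

Lemma isdiv_horder f D : isdiv f D <-> forall P, horder P f (coeff P D).
Proof. by split=> fD P; apply/horder_val. Qed.

Lemma val_constant P f n : constant emb f -> val P f n -> n = 0.
Proof.
move=> [c ->] fn; apply: (val_uniq fn); apply: val_cst.
by apply: contraTneq (val_neq0 fn) => ->; rewrite rmorph0 eqxx.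
Qed.

Lemma horder_cst P c : c != 0 -> horder P (emb c) 0.
Proof. by move=> c0; apply/horder_val/val_cst. Qed.

Lemma horder_gt0 P f n : horder P f n -> 0 < n -> hv P f 0.
Proof.
by move=> /horder_val v n0; apply/pw1_hv; apply: pw_le (val_pw v); rewrite -gtz0_ge1.
Qed.

Lemma no_degree_one P Q f : P != Q ->
  (forall R, horder R f (coeff R (<<P>> - <<Q>>))) -> g <= 0.
Proof.
move=> PQ /isdiv_horder fPQ; apply: (@poles_deg1 f (<<P>> - <<Q>>)) => //.
  have := fPQ P; rewrite coeffB !coeffU eqxx (eq_sym Q) (negbTE PQ) mulr0 subr0 => v.
  by move/(val_constant) => /(_ _ _ v).
suff -> : fgneg (<<P>> - <<Q>>) = <<Q>> :> {freeg X / int} by rewrite degU.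
apply/eqP/freeg_eqP=> R; rewrite coeff_fgnegE coeffB !coeffU !mul1r.
case: (eqVneq P R) PQ => [->|_ _]; first by rewrite eq_sym => /negbTE ->.
by case: (Q == R); rewrite ?subr0 ?sub0r ?oppr0.
Qed.

Section Double.
Hypotheses (d2 : d = 2%N) (g2 : 2 <= g).

Let nt : ~ constant emb t := dep_nonconstant dt.

Lemma poles_deg2 Dt : isdiv t Dt -> deg (fgneg Dt : {freeg X / int}) = 2.
Proof.
move=> tD; have E1 := poles_deg_gt0 nt tD.
have : deg (fgneg Dt : {freeg X / int}) != 1.
  by apply/eqP=> /(poles_deg1 nt tD); lia.
have t0 : t != 0 by have := nonconstant_neq 0 nt; rewrite rmorph0 subr0.
have : deg (fgneg Dt : {freeg X / int}) <= d%:Z.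
  apply: (@zeros_deg_le t^-1); first exact: depV.
  - by move=> [c tc]; apply: nt; exists c^-1; rewrite fmorphV -tc invrK.
  - exact: poles_ge0.
  move=> P Pp; have /(val_pole tD (P := P) 0) : coeff P (fgneg Dt) != 0 by rewrite gt_eqF.
  by rewrite rmorph0 subr0 => /valV /val_pw; rewrite opprK.
rewrite d2; lia.
Qed.

Lemma effective_deg2 D : (forall P, (0 : int) <= coeff P D) -> deg D = 2 ->
  exists P Q, D = <<P>> + <<Q>> /\ forall R, (0 : int) < coeff R D <-> R = P \/ R = Q.
Proof.
move=> /effective_seq [s ->]; rewrite deg_seq; case: s => [|P [|Q []]] // _.
exists P, Q; split; first by rewrite !sdiv_cons sdiv_nil addr0.
move=> R; rewrite !coeff_sdiv_cons sdiv_nil coeff0 addr0.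
case: (eqVneq P R) (eqVneq Q R) => [->|PR] [->|QR] //=; split=> //; try by left.
- by right.
- by case=> E; move: PR QR; rewrite E eqxx.
Qed.

Lemma fibre_pair c : exists P Q, forall R, hv R t c <-> R = P \/ R = Q.
Proof.
have t0 : t != 0 by have := nonconstant_neq 0 nt; rewrite rmorph0 subr0.
have [Dt tD] := isdiv_exists t0; have [Z [Z0 tZ hZ]] := fibre nt tD c.
have [P [Q [_ ZPQ]]] := effective_deg2 Z0 (etrans (fibre_deg tZ) (poles_deg2 tD)).
by exists P, Q => R; rewrite -ZPQ; split=> /hZ.
Qed.

Lemma lspace_double_poles Dt f : isdiv t Dt -> lspace (fgneg Dt *+ 2) f ->
  exists2 p : {poly k}, (size p <= 3)%N & f = ev emb t p.
Proof.
move=> tD fE; have [[p fp]|nf] := EM (exists p, f = ev emb t p).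
  by exists p => //; apply: (lspace_poly_size nt tD); rewrite -fp.
suff : g <= 1 by move/(le_trans g2).
apply: (@genus_bound t Dt nt tD 1 2) => n n2.
exists (n.+1 + n.-1)%N; last by rewrite (poles_deg2 tD); lia.
exists (fun i => match split i with inl i => t ^+ i | inr j => f * t ^+ j end).
split=> [i|c].
  case: (split i) => j; first by apply: poles_powers => //; have := ltn_ord j.
  have -> : fgneg Dt *+ n = fgneg Dt *+ 2 + fgneg Dt *+ (n - 2).
    by rewrite -mulrnDr subnKC.
  apply: lspaceM => //; apply: poles_powers => //.
  by have := ltn_ord j; lia.
rewrite big_split_ord /=.
under eq_bigr do rewrite (unsplitK (inl _)).
under [X in _ + X]eq_bigr do rewrite (unsplitK (inr _)) mulrCA.
rewrite -mulr_sumr.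
have [p [pE pev]] := poly_of_fun (fun i => c (lshift n.-1 i)).
have [q [qE qev]] := poly_of_fun (fun i => c (rshift n.+1 i)).
rewrite -pev -qev => pq.
have q0 : q = 0.
  apply/eqP/negPn/negP=> q0; apply: nf; apply: (lspace_rational nt tD fE q0 (p := - p)).
  by apply/eqP; rewrite evN -addr_eq0 addrC mulrC pq.
have p0 : p = 0 by apply: (ev_eq0 nt); rewrite -[RHS]pq q0 ev0 mulr0 addr0.
move=> i; rewrite -(splitK i); case: (split i) => j /=.
  by rewrite -pE p0 coef0.
by rewrite -qE q0 coef0.
Qed.

Lemma hyperelliptic_poles : exists P Q,
  (forall R, regular R t <-> R <> P /\ R <> Q) /\
  forall f, rr ((<<P>> + <<Q>>) *+ 2) f ->
    exists2 p : {poly k}, (size p <= 3)%N & f = ev emb t p.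
Proof.
have t0 : t != 0 by have := nonconstant_neq 0 nt; rewrite rmorph0 subr0.
have [Dt tD] := isdiv_exists t0.
have [P [Q [EPQ hPQ]]] := effective_deg2 (@poles_ge0 Dt) (poles_deg2 tD).
exists P, Q; split=> [R|f /rr_lspace]; last by rewrite -EPQ; apply: lspace_double_poles.
split=> [/(regular_poles tD) E0|[RP RQ]].
  have nPQ : ~ (R = P \/ R = Q) by move=> /(hPQ R).2; rewrite E0 ltxx.
  by split=> E; apply: nPQ; [left|right].
apply/(regular_poles tD); apply: le_anti; rewrite poles_ge0 andbT leNgt.
by apply/negP=> /hPQ [].
Qed.

End Double.

End Places.

(** * The function field of a curve *)

Section RationalFunctions.
Variables (k : closedFieldType) (F : fieldType) (emb : {rmorphism k -> F}).
Variables (t b0 b1 : F).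
Implicit Types f h x y : F.

Notation evt := (ev emb t).

Definition kgen f : Prop := exists p q : {poly k}, evt q != 0 /\ f = evt p / evt q.

Lemma kgen_cst c : kgen (emb c).
Proof. by exists c%:P, 1%:P; rewrite !evC rmorph1 divr1 oner_neq0. Qed.

Lemma kgenD f h : kgen f -> kgen h -> kgen (f + h).
Proof.
move=> [p [q [q0 ->]]] [p' [q' [q'0 ->]]]; exists (p * q' + p' * q), (q * q').
by rewrite evD !evM mulf_neq0 // addf_div.
Qed.

Lemma kgenM f h : kgen f -> kgen h -> kgen (f * h).
Proof.
move=> [p [q [q0 ->]]] [p' [q' [q'0 ->]]]; exists (p * p'), (q * q').
by rewrite !evM mulf_neq0 // mulf_div.
Qed.

Lemma kgenN f : kgen f -> kgen (- f).
Proof. by move=> [p [q [q0 ->]]]; exists (- p), q; rewrite evN mulNr. Qed.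

Definition kspan f : Prop := exists x y, [/\ kgen x, kgen y & f = x * b0 + y * b1].

Lemma kspanD f h : kspan f -> kspan h -> kspan (f + h).
Proof.
move=> [x [y [kx ky ->]]] [x' [y' [kx' ky' ->]]]; exists (x + x'), (y + y').
by split; [apply: kgenD..|rewrite !mulrDl addrACA].
Qed.

Lemma kspanZ x f : kgen x -> kspan f -> kspan (x * f).
Proof.
move=> kx [y [y' [ky ky' ->]]]; exists (x * y), (x * y').
by split; [apply: kgenM..|rewrite mulrDr !mulrA].
Qed.

Lemma kspan0 : kspan 0.
Proof.
have k0 := kgen_cst 0; rewrite rmorph0 in k0.
by exists 0, 0; rewrite !mul0r addr0.
Qed.

Lemma dep3_kgen (x y : 'I_3 -> F) : (forall i, kgen (x i)) -> (forall i, kgen (y i)) ->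
  exists q : 'I_3 -> F, [/\ forall i, kgen (q i), exists i, q i != 0,
    \sum_i q i * x i = 0 & \sum_i q i * y i = 0].
Proof.
move=> kx ky.
pose mk (a0 a1 a2 : F) (i : 'I_3) := nth 0 [:: a0; a1; a2] i.
have mkP a0 a1 a2 : kgen a0 -> kgen a1 -> kgen a2 ->
    [|| a0 != 0, a1 != 0 | a2 != 0] ->
    a0 * x 0 + a1 * x 1 + a2 * x 2%R = 0 -> a0 * y 0 + a1 * y 1 + a2 * y 2%R = 0 ->
    exists q : 'I_3 -> F, [/\ forall i, kgen (q i), exists i, q i != 0,
      \sum_i q i * x i = 0 & \sum_i q i * y i = 0].
  move=> k0 k1 k2 nz sx sy; exists (mk a0 a1 a2); split.
  - by case=> [[|[|[]]]].
  - by case/or3P: nz => nz; [exists 0|exists 1|exists 2%R].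
  - rewrite !big_ord_recl big_ord0 addr0 addrA -[RHS]sx /mk /=.
    by congr (_ + _ * x _ + _ * x _); apply: val_inj.
  - rewrite !big_ord_recl big_ord0 addr0 addrA -[RHS]sy /mk /=.
    by congr (_ + _ * y _ + _ * y _); apply: val_inj.
have k0 : kgen 0 by have := kgen_cst 0; rewrite rmorph0.
have k1 : kgen 1 by have := kgen_cst 1; rewrite rmorph1.
have [m0|m0] := eqVneq (x 0 * y 1 - x 1 * y 0) 0; last first.
  apply: (mkP (x 1 * y 2%R - x 2%R * y 1) (x 2%R * y 0 - x 0 * y 2%R) (x 0 * y 1 - x 1 * y 0));
    try (by apply: kgenD; [|apply: kgenN]; apply: kgenM); try ring.
  by rewrite m0 !orbT.
have [x0|x0] := eqVneq (x 0) 0; last first.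
  apply: (mkP (x 1) (- x 0) 0) => //; try exact: kgenN; try (by rewrite oppr_eq0 x0 orbT); try ring.
  by rewrite mul0r addr0 -[RHS]oppr0 -m0; ring.
have [y0|y0] := eqVneq (y 0) 0; last first.
  apply: (mkP (y 1) (- y 0) 0) => //; try exact: kgenN; try (by rewrite oppr_eq0 y0 orbT); try ring.
  by rewrite mul0r addr0 -[RHS]m0; ring.
by apply: (mkP 1 0 0) => //; rewrite ?oner_neq0 // ?x0 ?y0 !mul0r ?mulr0 !addr0.
Qed.


Lemma dep2_kspan : (forall z : 'I_3 -> F, exists2 B, B != 0 & forall i, kspan (z i * B)) ->
  dep emb 2 t.
Proof.
move=> span z; have [B B0 zB] := span z.
have /choice [x /choice [y xyP]] : forall i, exists x y, [/\ kgen x, kgen y &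
    z i * B = x * b0 + y * b1] := zB.
have kx i : kgen (x i) by have [] := xyP i.
have ky i : kgen (y i) by have [] := xyP i.
have [q [kq [i0 qi0] qx qy]] := dep3_kgen kx ky.
have qz : \sum_i q i * z i = 0.
  apply: (mulIf B0); rewrite mul0r mulr_suml.
  have zE i : z i * B = x i * b0 + y i * b1 by have [] := xyP i.
  under eq_bigr do rewrite -mulrA zE mulrDr !mulrA.
  by rewrite big_split /= -!mulr_suml qx qy !mul0r addr0.
have /choice [p /choice [r prP]] : forall i, exists p r : {poly k},
  evt r != 0 /\ q i = evt p / evt r := kq.
have r0 i : evt (r i) != 0 by have [] := prP i.
have qE i : q i = evt (p i) / evt (r i) by have [] := prP i.
have evp (Q : pred 'I_3) : evt (\prod_(l | Q l) r l) = \prod_(l | Q l) evt (r l).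
  by elim/big_rec2: _ => [|l u v _ <-]; rewrite ?evC ?rmorph1 ?evM // -[1]/(1%:P) evC rmorph1.
have qr i : evt (p i * \prod_(l | l != i) r l) = q i * \prod_l evt (r l).
  by rewrite evM evp [in RHS](bigD1 i) //= [RHS]mulrA qE divfK.
have rn0 : \prod_l evt (r l) != 0 by apply/prodf_neq0 => l _.
exists (fun i => p i * \prod_(l | l != i) r l); split.
  by exists i0; rewrite qr mulf_neq0.
under eq_bigr do rewrite qr mulrAC.
by rewrite -mulr_suml qz mul0r.
Qed.


End RationalFunctions.

Lemma kspan_sum (k : closedFieldType) (F : fieldType) (emb : {rmorphism k -> F}) (t : F)
    (b c : 'I_2 -> F) : (forall i, kgen emb t (c i)) ->
  kspan emb t (b 0) (b 1) (\sum_i c i * b i).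
Proof.
move=> kc; exists (c 0), (c 1); split=> //; rewrite !big_ord_recl big_ord0 addr0.
by congr (_ + c _ * b _); apply: val_inj.
Qed.

Section CurvePlaces.
Variable C : curve.
Notation F := (funfield C).
Notation M := {mpoly algC[(amb C).+1]}.
Notation hvC := (@has_value C).
Implicit Types (P : Cpoint C) (A B : M) (f : F).

Lemma nonvanishing P B : B.@[P 0] != 0 -> ~ vanishes (C := C) B.
Proof. by move=> BP vB; rewrite vB eqxx in BP. Qed.

Lemma point_coord P : exists j, P 0 j = 1 :> algC.
Proof.
by have /andP[/existsP[j /andP[/eqP Pj _]] _] := coordsP P; exists j.
Qed.

Lemma dhomogXn (j : 'I_(amb C).+1) d : ('X_j ^+ d : M) \is d.-homog.
Proof.
have hX : ('X_j : M) \is 1.-homog by rewrite dhomogX /= mdeg1.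
by have := dhomogMn d hX; rewrite mul1n.
Qed.

Lemma meval_coord P j d : P 0 j = 1 -> ('X_j ^+ d : M).@[P 0] = 1.
Proof. by move=> Pj; rewrite rmorphXn /= mevalXU Pj expr1n. Qed.

Lemma has_value_ratio P A B : is_fraction (C := C) (A, B) -> B.@[P 0] != 0 ->
  hvC P (@Defs.ratio C A B) (A.@[P 0] / B.@[P 0]).
Proof. by move=> fAB BP; exists A, B. Qed.

Lemma curve_places : places (cst C) hvC.
Proof.
split.
- move=> P c; have := has_value_ratio (P := P) (is_fractionC C c).
  by rewrite meval1 oner_neq0 mevalC divr1; apply.
- move=> P f h c e [A [B [[fAB ->] BP ->]]] [A' [B' [[fAB' ->] BP' ->]]].
  exists (A * B' + A' * B), (B * B'); split; last 2 first.
  + by rewrite mevalM mulf_neq0.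
  + by rewrite mevalD !mevalM addf_div.
  split; first exact: is_fractionD.
  by rewrite -(addffE fAB fAB').
- move=> P f h c e [A [B [[fAB ->] BP ->]]] [A' [B' [[fAB' ->] BP' ->]]].
  exists (A * A'), (B * B'); split; last 2 first.
  + by rewrite mevalM mulf_neq0.
  + by rewrite !mevalM mulf_div.
  split; first exact: is_fractionM.
  by rewrite -(mulffE fAB fAB').
- move=> P f c [A [B [[fAB ->] BP ->]]]; rewrite mulf_eq0 invr_eq0 negb_or => /andP[AP _].
  exists B, A; split=> //; last by rewrite invf_div.
  have nA := nonvanishing AP; split; first exact: is_fractionV.
  by rewrite -(invffE fAB nA).
- move=> P f c e [A [B [[fAB ->] BP ->]]] [A' [B' [[fAB' E] BP' ->]]].
  have /(ratioP fAB fAB') /(_ P) := E; rewrite mevalB !mevalM => /eqP.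
  by rewrite subr_eq0 => /eqP e0; apply/eqP; rewrite eqr_div // e0.
move=> P f; elim/Defs.ratio_ind: f => A B fAB.
have [j Pj] := point_coord P; have [[d /= [hA hB]] nB] := fAB.
pose Y : M := 'X_j ^+ d.
have YP : Y.@[P 0] = 1 by apply: meval_coord.
have Y0 : Y.@[P 0] != 0 by rewrite YP oner_neq0.
have nY := nonvanishing Y0.
have fr G : G \is d.-homog -> is_fraction (C := C) (G, Y).
  by move=> hG; split=> //; exists d; split=> //; apply: dhomogXn.
exists (@Defs.ratio C A Y), (@Defs.ratio C B Y); split.
- by exists (A.@[P 0] / Y.@[P 0]); apply: has_value_ratio => //; apply: fr.
- by exists (B.@[P 0] / Y.@[P 0]); apply: has_value_ratio => //; apply: fr.
have fYB := is_fractionV (fr _ hB) nB.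
transitivity (mulff (@Defs.ratio C A Y) (invff (@Defs.ratio C B Y))); last by [].
rewrite (invffE (fr _ hB) nB) (mulffE (fr _ hA) fYB); apply/ratioP => //.
  exact: is_fractionM (fr _ hA) fYB.
by apply: vanishes_eq0; ring.
Qed.

Lemma curve_riemann g : genus C g -> riemann (cst C) hvC g.
Proof.
move=> [le_g [D [r [dr gE]]]]; split=> [D' r' sD dr'|].
  by apply: le_g; have := dim_eq_coord sD dr'.
by exists D, r; split=> //; apply: coord_dim_eq; [exact: dr|left].
Qed.

Section Degree.
Variables (t : F) (b : 'I_2 -> F).
Hypothesis b_span : forall f, Qfunfield f -> exists c : {ffun 'I_2 -> F},
  (forall i, Qgenerated t (c i)) /\ f = \sum_i c i * b i.

Notation kgenC := (kgen (cst C) t).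
Notation kspanC := (kspan (cst C) t (b 0) (b 1)).

Lemma Qgenerated_kgen f : Qgenerated t f -> kgenC f.
Proof.
move=> [p [q [q0 ->]]]; exists (map_poly ratr p), (map_poly ratr q).
by rewrite /ev -!map_poly_comp.
Qed.

Lemma Qfunfield_kspan f : Qfunfield f -> kspanC f.
Proof.
by move=> /b_span [c [kc ->]]; apply: kspan_sum => i; apply: Qgenerated_kgen.
Qed.

Lemma ratioDl A A' B : is_fraction (C := C) (A, B) -> is_fraction (C := C) (A', B) ->
  @Defs.ratio C (A + A') B = @Defs.ratio C A B + @Defs.ratio C A' B.
Proof.
move=> fA fA'; rewrite -[RHS]/(addff _ _) (addffE fA fA').
have [[d /= [hA hB]] nB] := fA; have [[d' /= [hA' hB']] _] := fA'.
have dd' : d = d'.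
  apply: (dhomog_uniq _ hB hB'); apply/eqP=> B0; apply: nB; rewrite B0.
  exact: vanishes0.
apply/ratioP; [|exact: is_fractionD|apply: vanishes_eq0; ring].
by split=> //; exists d; split=> //; apply: rpredD => //; rewrite dd'.
Qed.

Lemma ratioZ c A B : is_fraction (C := C) (A, B) ->
  @Defs.ratio C (c *: A) B = cst C c * @Defs.ratio C A B.
Proof.
move=> fA; rewrite -[RHS]/(mulff _ _) (mulffE (is_fractionC C c) fA).
by rewrite mul1r mul_mpolyC.
Qed.

Lemma form_kspan d (j : 'I_(amb C).+1) A : ~ vanishes (C := C) 'X_j -> A \is d.-homog ->
  is_fraction (C := C) (A, 'X_j ^+ d) /\ kspanC (@Defs.ratio C A ('X_j ^+ d)).
Proof.
move=> nXj hA.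
have nX : ~ vanishes (C := C) ('X_j ^+ d).
  move=> vX; apply: nXj => P; have /eqP := vX P; rewrite rmorphXn /= expf_eq0.
  by case/andP=> _ /eqP.
have fr G : G \is d.-homog -> is_fraction (C := C) (G, 'X_j ^+ d).
  by move=> hG; split=> //; exists d; split=> //; apply: dhomogXn.
split; first exact: fr.
have /dhomogP dA := hA; rewrite (mpolyE A).
suff [] : (\sum_(m <- msupp A) A@_m *: 'X_[m]) \is d.-homog /\
  kspanC (@Defs.ratio C (\sum_(m <- msupp A) A@_m *: 'X_[m]) ('X_j ^+ d)) by [].
have {dA} : {in msupp A, forall m, mdeg m = d} by [].
elim: (msupp A) => [|m s IH] dm.
  rewrite big_nil; split; first exact: rpred0.
  have -> : @Defs.ratio C 0 ('X_j ^+ d) = 0 by apply/(ratio_eq0 (fr _ (rpred0 _)))/vanishes0.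
  exact: kspan0.
have [|hs ks] := IH; first by move=> m' m's; apply: dm; rewrite inE m's orbT.
have hm : ('X_[m] : M) \is d.-homog by rewrite dhomogX; apply/eqP/dm/mem_head.
rewrite big_cons; split; first by apply: rpredD => //; apply: rpredZ.
rewrite ratioDl; [|by apply: fr; apply: rpredZ|exact: fr].
apply: kspanD => //; rewrite ratioZ; last exact: fr.
apply: kspanZ; first exact: kgen_cst.
apply: Qfunfield_kspan; exists 'X_[m], ('X_j ^+ d).
by rewrite rmorphXn /= !map_mpolyX; split=> //; apply: fr.
Qed.

Lemma common_denominator n (z : 'I_n -> F) : exists d (A : 'I_n -> M) B,
  [/\ B \is d.-homog, ~ vanishes (C := C) B &
      forall i, A i \is d.-homog /\ z i = @Defs.ratio C (A i) B].
Proof.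
elim: n => [|n IH] in z *.
  exists 0%N, (fun=> 0), 1; split=> [||[]//]; [exact: dhomog1|exact: vanishes1].
have [d [A [B [hB nB zA]]]] := IH (fun i => z (lift ord0 i)).
elim/Defs.ratio_ind: {-1}(z ord0) (erefl (z ord0)) => A0 B0 fr0 z0.
have [[e /= [hA0 hB0]] nB0] := fr0.
have nBB : ~ vanishes (C := C) (B0 * B) by move/(vanishesM hB0 hB) => [].
exists (e + d)%N, (fun i => if unlift ord0 i is Some j then B0 * A j else A0 * B), (B0 * B).
split=> // [|i]; first exact: dhomogM.
have fr G : G \is (e + d).-homog -> is_fraction (C := C) (G, B0 * B).
  by move=> hG; split=> //; exists (e + d)%N; split=> //; apply: dhomogM.
case: unliftP => [j ->|->].
  have [hA zE] := zA j; have hBA : B0 * A j \is (e + d).-homog by apply: dhomogM.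
  split=> //; rewrite zE; apply/ratioP; [|exact: fr|by apply: vanishes_eq0; ring].
  by split=> //; exists d.
have hAB : A0 * B \is (e + d).-homog by apply: dhomogM.
split=> //; rewrite z0; apply/ratioP; [exact: fr0|exact: fr|by apply: vanishes_eq0; ring].
Qed.

Lemma curve_dep : dep (cst C) 2 t.
Proof.
apply: (dep2_kspan (b0 := b 0) (b1 := b 1)) => z.
have [d [A [B [hB nB zA]]]] := common_denominator z.
have [[P0 _] _] := geom_irreducible C; have [j Pj] := point_coord P0.
have nX : ~ vanishes (C := C) 'X_j.
  by apply: (@nonvanishing P0); rewrite mevalXU Pj oner_neq0.
have [frB _] := form_kspan nX hB.
exists (@Defs.ratio C B ('X_j ^+ d)); first by apply/eqP=> /(ratio_eq0 frB).
move=> i; have [hA ->] := zA i; have [frA kA] := form_kspan nX hA.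
have frAB : is_fraction (C := C) (A i, B) by split=> //; exists d.
suff -> : @Defs.ratio C (A i) B * @Defs.ratio C B ('X_j ^+ d) =
  @Defs.ratio C (A i) ('X_j ^+ d) by [].
rewrite -[LHS]/(mulff _ _) (mulffE frAB frB); apply/ratioP; [exact: is_fractionM|exact: frA|].
by apply: vanishes_eq0; ring.
Qed.

End Degree.
End CurvePlaces.

(** * Conjugates and embeddings of number fields *)

Section NumberFields.
Implicit Types (s : {rmorphism algC -> algC}).
Notation pQtoC := (map_poly (ratr : rat -> algC)).

Lemma in_alg_map_poly (K : fieldExtType rat) (f : {rmorphism K -> algC}) (p : {poly rat}) :
  map_poly f (map_poly (in_alg K) p) = pQtoC p.
Proof. by rewrite -map_poly_comp; apply: eq_map_poly => a /=; rewrite alg_num_field fmorph_rat. Qed.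

Lemma conj_exists (x y : algC) : root (minCpoly x) y -> exists s, s x = y.
Proof.
have [r] := closed_field_poly_normal (minCpoly x).
rewrite (monicP (minCpoly_monic x)) scale1r => Dr ry.
have [Q [QC [r1 r1E genQ]]] := num_field_exists r.
have inr z : root (minCpoly x) z -> exists2 z1, z1 \in r1 & QC z1 = z.
  by rewrite Dr root_prod_XsubC -r1E => /mapP[z1 z1r ->]; exists z1.
have [x1 x1r x1E] := inr x (root_minCpoly x); have [y1 y1r y1E] := inr y ry.
have [p [pE _ p_dvd]] := minCpolyP x.
have hom1 : kHom 1 1 (\1%VF : 'End(Q)) by rewrite kHom1.
have rt : root (map_poly \1%VF (minPoly 1 x1)) y1.
  have /polyOver1P [q qE] := minPolyOver 1 x1.
  have -> : map_poly \1%VF (minPoly 1 x1) = minPoly 1 x1.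
    by apply/polyP=> i; rewrite coef_map_id0 ?raddf0 // id_lfunE.
  have : root (map_poly QC (minPoly 1 x1)) x by rewrite -x1E fmorph_root root_minPoly.
  rewrite -(fmorph_root QC) y1E qE in_alg_map_poly p_dvd => /dvdpP[u ->].
  by rewrite rmorphM rootM /= -pE ry orbT.
have hphi := kHomExtendP (subvv 1) hom1 rt; have phix := kHomExtend_val hom1 rt.
have pK : map_poly (in_alg Q) p \is a polyOver 1%VS by apply: alg_polyOver.
have split : splittingFieldFor <<1; x1>> (map_poly (in_alg Q) p) {:Q}.
  exists r1; last first.
    by apply/eqP; rewrite eqEsubv subvf -genQ adjoin_seqSl // sub1v.
  suff -> : map_poly (in_alg Q) p = \prod_(z <- r1) ('X - z%:P) by apply: eqpxx.
  apply: (map_poly_inj QC); rewrite in_alg_map_poly -pE Dr -r1E big_map rmorph_prod.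
  by apply: eq_bigr => z _; rewrite /= rmorphB /= map_polyX map_polyC.
have [g homg gE] := kHom_extends (sub1v _) hphi pK split.
have gm : monoid_morphism g by apply/kHom_monoid_morphism.
pose gM := GRing.isMonoidMorphism.Build _ _ (fun_of_lfun g) gm.
pose gRM : {rmorphism _ -> _} := HB.pack (fun_of_lfun g) gM.
have [s sE] := extend_algC_subfield_aut QC gRM.
by exists s; rewrite -x1E -sE /= -gE ?memv_adjoin // phix.
Qed.

Lemma fixed_rational (x : algC) : (forall s, s x = x) -> exists a, x = ratr a.
Proof.
move=> fx; have [r] := closed_field_poly_normal (minCpoly x).
rewrite (monicP (minCpoly_monic x)) scale1r => Dr.
have rx z : z \in r -> z = x.
  by rewrite -root_prod_XsubC -Dr => /conj_exists [s <-].
have r0 : size r != 0%N.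
  by have := size_minCpoly x; rewrite Dr size_prod_XsubC; case: (size r).
have := coefPn_prod_XsubC r0; rewrite -Dr.
have -> : \sum_(z <- r) z = x * (size r)%:R.
  rewrite big_seq (eq_bigr (fun=> x)) => [|z /rx //]; rewrite -big_seq big_const_seq.
  by rewrite count_predT iter_addr_0 mulr_natr.
have [p [-> _ _]] := minCpolyP x; rewrite coef_map /= => cE.
exists (- p`_(size r).-1 / (size r)%:R).
by rewrite fmorph_div rmorphN rmorph_nat /= cE opprK mulfK // pnatr_eq0.
Qed.

Section Embeddings.
Variables (K : fieldExtType rat) (th : K).
Hypothesis gen : <<1; th>>%VS = fullv.

Lemma gen_poly (y : K) : exists q : {poly rat}, y = (map_poly (in_alg K) q).[th].
Proof.
have : y \in <<1; th>>%VS by rewrite gen memvf.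
by case/Fadjoin_polyP => p /polyOver1P [q ->] ->; exists q.
Qed.

Lemma embedding_eq (f h : {rmorphism K -> algC}) : f th = h th -> f =1 h.
Proof.
move=> fh y; have [q ->] := gen_poly y.
by rewrite -!horner_map !in_alg_map_poly fh.
Qed.

Lemma embedding_exists (p : {poly rat}) z :
  map_poly (in_alg K) p = minPoly 1 th -> root (pQtoC p) z ->
  exists f : {rmorphism K -> algC}, f th = z.
Proof.
move=> pE pz; have /choice [q qE] := gen_poly.
pose f y := (pQtoC (q y)).[z].
have f_eq y (u : {poly rat}) : y = (map_poly (in_alg K) u).[th] -> f y = (pQtoC u).[z].
  move=> yE; apply/eqP; rewrite -subr_eq0 -hornerN -hornerD -rmorphN -rmorphD.
  rewrite -/(root _ _); have : root (map_poly (in_alg K) (q y - u)) th.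
    by rewrite /root rmorphB hornerD hornerN -qE -yE subrr.
  move=> rt; have : map_poly (in_alg K) p %| map_poly (in_alg K) (q y - u).
    by rewrite pE; apply: (minPoly_dvdp (K := 1%AS)) rt; apply: alg_polyOver.
  rewrite dvdp_map => /dvdpP[v ->].
  by rewrite rmorphM rootM pz orbT.
have fB : zmod_morphism f.
  move=> y y'; rewrite (f_eq (y - y') (q y - q y')) ?rmorphB ?hornerD ?hornerN //=.
  by rewrite -!qE.
have fM : monoid_morphism f.
  split=> [|y y']; first by rewrite (f_eq 1 1) rmorph1 hornerC.
  rewrite (f_eq (y * y') (q y * q y')) ?rmorphM ?hornerM //=; by rewrite -!qE.
pose fBm := GRing.isZmodMorphism.Build K algC f fB.
pose fMm := GRing.isMonoidMorphism.Build K algC f fM.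
pose fRM : {rmorphism K -> algC} := HB.pack f fBm fMm.
by exists fRM; rewrite /= (f_eq th 'X) map_polyX hornerX.
Qed.

Lemma embeddings : exists f : 'I_(\dim {:K}) -> {rmorphism K -> algC},
  injective (fun i => f i th) /\
  forall s i, exists j, forall y, s (f i y) = f j y.
Proof.
have /polyOver1P [p pE] := minPolyOver 1 th; rewrite /= in pE.
have [r] := closed_field_poly_normal (pQtoC p).
have p_monic : p \is monic by rewrite -(map_monic (in_alg K)) -pE monic_minPoly.
rewrite lead_coef_map (monicP p_monic) rmorph1 scale1r => pr.
have szr : size r = \dim {:K}.
  have := size_prod_XsubC r id; rewrite -pr size_map_poly -(size_map_poly (in_alg K)) -pE.
  by rewrite size_minPoly => -[<-]; have := dim_Fadjoin 1 th; rewrite gen dimv1 muln1.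
have ur : uniq r.
  rewrite -separable_prod_XsubC -pr separable_map -(separable_map (in_alg K)) -pE.
  have ch : [pchar K] =i pred0 by move=> l; rewrite pchar_lalg pchar_num.
  exact: (pcharf0_separable 1%AS ch).
have rootr i : root (pQtoC p) r`_(i : 'I_(\dim {:K})).
  by rewrite pr root_prod_XsubC mem_nth // szr.
have /choice [f fE] : forall i : 'I_(\dim {:K}), exists f : {rmorphism K -> algC}, f th = r`_i.
  by move=> i; apply: embedding_exists (esym pE) (rootr i).
exists f; split=> [i j|s i].
  by rewrite !fE => /eqP; rewrite nth_uniq ?szr // => /eqP/val_inj.
have : s (f i th) \in r.
  rewrite -root_prod_XsubC -pr fE.
  have <- : map_poly s (pQtoC p) = pQtoC p.
    by rewrite -map_poly_comp; apply: eq_map_poly => a /=; rewrite fmorph_rat.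
  by rewrite fmorph_root; apply: rootr.
case/(nthP 0) => l; rewrite szr => lr lE; exists (Ordinal lr) => y.
by apply: (embedding_eq (f := s \o f i)); rewrite /= [RHS]fE lE.
Qed.

End Embeddings.

Section Quadratic.
Variables (m : int) (d : algC).
Hypothesis (dm : d ^+ 2 = m%:~R).

Lemma quadratic_square (a b : rat) (q : algC) : d \notin Crat ->
  q \in Crat -> (ratr a + ratr b * d) ^+ 2 = q ->
  q = ratr a ^+ 2 \/ q = ratr b ^+ 2 * m%:~R.
Proof.
move=> nd Cq E.
have E2 : q = ratr a ^+ 2 + ratr b ^+ 2 * m%:~R + ratr (a * b *+ 2) * d.
  by rewrite -E -dm mulr2n rmorphD rmorphM /=; ring.
have [ab|ab] := eqVneq (a * b *+ 2) 0; last first.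
  case/negP: nd; have -> : d = (q - ratr a ^+ 2 - ratr b ^+ 2 * m%:~R) / ratr (a * b *+ 2).
    apply: (canRL (mulfK _)); first by rewrite fmorph_eq0.
    by rewrite E2; ring.
  have Cr (c : rat) : (ratr c : algC) \in Crat by exact: Crat_rat.
  have Cm : (m%:~R : algC) \in Crat.
    by rewrite -(rmorph_int (ratr : {rmorphism rat -> algC})) Crat_rat.
  apply: rpred_div; last exact: Cr.
  apply: rpredB; last by apply: rpredM => //; apply: rpredX; apply: Cr.
  by apply: rpredB => //; apply: rpredX; apply: Cr.
move: ab => /eqP; rewrite mulrn_eq0 /= mulf_eq0 => /orP[/eqP a0|/eqP b0]; [right|left].
  by rewrite E2 a0 mul0r mul0rn !rmorph0 mul0r expr0n /= add0r addr0.
by rewrite E2 b0 mulr0 mul0rn !rmorph0 expr0n /= !mul0r !addr0.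
Qed.

End Quadratic.

Lemma prime_not_square (p : nat) (M : int) (a : rat) : prime p -> ~~ (p %| `|M|)%N ->
  (p%:R : algC) <> ratr a ^+ 2 * M%:~R.
Proof.
move=> pp pM; rewrite -[M%:~R](rmorph_int (ratr : {rmorphism rat -> algC})).
rewrite -(rmorph_nat (ratr : {rmorphism rat -> algC})) -rmorphXn -rmorphM /= => /fmorph_inj.
rewrite -{1}(divq_num_den a) exprMn exprVn => E.
have d0 : (denq a)%:~R != 0 :> rat by rewrite intr_eq0 denq_neq0.
have {E} E : p%:Z * denq a ^+ 2 = numq a ^+ 2 * M.
  apply/eqP; rewrite -(eqr_int rat) !expr2 !intrM -pmulrn E; apply/eqP.
  by field.
have {E} E : (p * `|denq a| ^ 2 = `|numq a| ^ 2 * `|M|)%N.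
  by have := congr1 absz E; rewrite !expr2 !abszM absz_nat !mulnn.
have dn : (0 < `|denq a|)%N by rewrite absz_gt0 denq_neq0.
have : (0 < p * `|denq a| ^ 2)%N by rewrite muln_gt0 prime_gt0 // expn_gt0 dn.
rewrite {1}E muln_gt0 expn_gt0 orbF => /andP[n0 M0].
have := congr1 (logn p) E; rewrite -!mulnn !lognM ?muln_gt0 ?n0 ?dn ?M0 ?(prime_gt0 pp) //.
rewrite (logn_prime p pp) eqxx (lognE p `|M|) (negbTE pM) !andbF; lia.
Qed.
End NumberFields.

(** * Galois action on points and divisors *)

Section BaseChange.
Variables (K L : fieldType) (f : {rmorphism K -> L}).
Variables (iK : {rmorphism rat -> K}) (iL : {rmorphism rat -> L}).

Lemma rat_morphism_eq a : f (iK a) = iL a.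
Proof. by rewrite (fmorph_eq_rat iL); apply: (fmorph_eq_rat (f \o iK)). Qed.

Lemma meval_morphism n (p : {mpoly rat[n]}) (v : 'I_n -> K) (w : 'I_n -> L) :
  (forall i, w i = f (v i)) -> (map_mpoly iL p).@[w] = f (map_mpoly iK p).@[v].
Proof.
move=> wE; elim/mpolyind: p => [|c m p _ _ IH]; first by rewrite !(raddf0, meval0).
rewrite !raddfD /= !map_mpolyZ !map_mpolyX !mevalZ !mevalX IH.
rewrite rmorphM rmorph_prod rat_morphism_eq; congr (_ * _ + _).
by apply: eq_bigr => i _; rewrite rmorphXn wE.
Qed.

Lemma normalized_morphism n (v : 'rV[K]_n.+1) : normalized (map_mx f v) = normalized v.
Proof.
apply: eq_existsb => i; rewrite mxE fmorph_eq1; congr (_ && _).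
by apply: eq_forallb => j; rewrite mxE fmorph_eq0.
Qed.

Lemma on_scheme_morphism (X : proj_scheme) (v : 'rV[K]_(amb X).+1) :
  on_scheme (X := X) iL (map_mx f v) = on_scheme (X := X) iK v.
Proof.
apply: eq_in_all => p _; rewrite (@meval_morphism _ _ (v 0)) ?fmorph_eq0 // => i.
by rewrite mxE.
Qed.

Lemma point_morphism (X : proj_scheme) (v : 'rV[K]_(amb X).+1) :
  normalized (map_mx f v) && on_scheme (X := X) iL (map_mx f v) =
  normalized v && on_scheme (X := X) iK v.
Proof. by rewrite normalized_morphism on_scheme_morphism. Qed.

End BaseChange.

Lemma map_mx_inj (K L : fieldType) (f : {rmorphism K -> L}) m n :
  injective (map_mx f : 'M_(m, n) -> 'M_(m, n)).
Proof.
by move=> A B /matrixP AB; apply/matrixP=> i j; have := AB i j; rewrite !mxE => /fmorph_inj.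
Qed.

Lemma dhomog_map_ratr n d (p : {mpoly rat[n]}) : p \is d.-homog ->
  map_mpoly (ratr : rat -> algC) p \is d.-homog.
Proof.
move=> /dhomogP hp; apply/dhomogP => m; rewrite mcoeff_msupp mcoeff_map_mpoly /= fmorph_eq0.
by rewrite -mcoeff_msupp => /hp.
Qed.

Section GaloisOrbits.
Variable C : curve.
Implicit Types (P Q R : Cpoint C) (s : {rmorphism algC -> algC}).

Lemma galois_point_inj s : injective (galois_point (C := C) s).
Proof.
by move=> P Q /(congr1 (@coords _ _ _)) /map_mx_inj PQ; apply: val_inj.
Qed.

Lemma meval_galois_point s (p : {mpoly rat[(amb C).+1]}) P :
  (map_mpoly ratr p).@[galois_point s P 0] = s (map_mpoly ratr p).@[P 0].
Proof. by apply: meval_morphism => i; rewrite mxE. Qed.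

HB.instance Definition _ s :=
  GRing.isZmodMorphism.Build {freeg (Cpoint C) / int} {freeg (Cpoint C) / int}
    (galois_divisor (C := C) s) (lift_is_additive _).

Lemma galois_divisorU s P : galois_divisor s << P >> = << galois_point s P >>.
Proof. by rewrite /galois_divisor liftU scale1r. Qed.

Lemma galois_divisor_sum s n (P : 'I_n -> Cpoint C) :
  galois_divisor s (\sum_i << P i >>) = \sum_i << galois_point s (P i) >>.
Proof. by rewrite raddf_sum; apply: eq_bigr => i _; apply: galois_divisorU. Qed.

Definition galois_fixed P : Prop := forall s, galois_point s P = P.

End GaloisOrbits.

Section Coordinate.
Variables (C : curve) (t : funfield C).
Implicit Types (P Q R : Cpoint C) (s : {rmorphism algC -> algC}).
Notation hvC := (@has_value C).
Notation M := {mpoly rat[(amb C).+1]}.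
Notation pl := (curve_places C).

Definition local_form P (A B : M) : Prop :=
  let A' := map_mpoly ratr A in let B' := map_mpoly ratr B in
  [/\ represents A' B' t & (A'.@[P 0] != 0) || (B'.@[P 0] != 0)].

Hypothesis t_local : forall P, exists A B, local_form P A B.

Lemma local_value P A B : local_form P A B -> (map_mpoly ratr B).@[P 0] != 0 ->
  hvC P t ((map_mpoly ratr A).@[P 0] / (map_mpoly ratr B).@[P 0]).
Proof. by move=> [rAB _] BP; exists (map_mpoly ratr A), (map_mpoly ratr B). Qed.

Lemma local_pole P A B : local_form P A B -> (map_mpoly ratr B).@[P 0] = 0 ->
  hvC P t^-1 0.
Proof.
move=> [[fAB tE] nz] B0; move: nz; rewrite B0 eqxx orbF => AP.
have nA := nonvanishing AP.
exists (map_mpoly ratr B), (map_mpoly ratr A); split; rewrite ?B0 ?mul0r //.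
split; first exact: is_fractionV.
by rewrite tE -(invffE fAB nA).
Qed.

Lemma coordinate_place P : regular hvC P t \/ hvC P t^-1 0.
Proof.
have [A [B AB]] := t_local P.
have [B0|BP] := eqVneq (map_mpoly ratr B).@[P 0] 0; first by right; apply: local_pole AB B0.
by left; eexists; apply: local_value AB BP.
Qed.

Hypothesis t0 : t != 0.

Lemma pole_not_regular P : hvC P t^-1 0 -> ~ regular hvC P t.
Proof.
move=> tV [c tc]; have := hvM pl tc tV; rewrite mulr0 mulfV //.
by move=> /(hv_inj pl (hv1 pl P)) /eqP; rewrite oner_eq0.
Qed.

Lemma local_denominator P A B : local_form P A B ->
  regular hvC P t <-> (map_mpoly ratr B).@[P 0] != 0.
Proof.
move=> AB; split=> [rt|BP]; last by eexists; apply: local_value AB BP.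
by apply/eqP=> B0; apply: (pole_not_regular (local_pole AB B0)).
Qed.

Lemma local_form_galois s P A B : local_form P A B -> local_form (galois_point s P) A B.
Proof. by move=> [rAB nz]; split=> //; rewrite 2!meval_galois_point 2!(fmorph_eq0 s). Qed.

Lemma regular_galois s P : regular hvC (galois_point s P) t <-> regular hvC P t.
Proof.
have [A [B AB]] := t_local P; rewrite (local_denominator (local_form_galois s AB)).
by rewrite meval_galois_point fmorph_eq0 (local_denominator AB).
Qed.

Lemma value_galois s P c : hvC P t c -> hvC (galois_point s P) t (s c).
Proof.
move=> tc; have [A [B AB]] := t_local P.
have BP : (map_mpoly ratr B).@[P 0] != 0 by apply/(local_denominator AB); exists c.
rewrite (hv_inj pl tc (local_value AB BP)) fmorph_div -!meval_galois_point.
by apply: local_value; [apply: local_form_galois|rewrite meval_galois_point fmorph_eq0].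
Qed.

End Coordinate.

Lemma hyperelliptic_coordinate (C : curve) : hyperelliptic C ->
  exists t : funfield C, dep (cst C) 2 t /\
    forall P, exists A B, local_form t P A B.
Proof.
move=> [_ [phi [Qphi [t [[A0 [B0 [[fAB0 tE] gAB0]]] [b [_ bP]]]]]]].
exists t; split.
  by apply: (@curve_dep C t b) => f /bP [c [cP _]]; exists c.
move=> P; have [A [B [d /= [hA hB nz gAB]]]] := Qphi P; exists A, B.
set A' := map_mpoly ratr A in nz gAB *; set B' := map_mpoly ratr B in nz gAB *.
have trivial_given (E G : {mpoly algC[(amb C).+1]}) (R : Cpoint C) : given_by phi E G ->
    E.@[R 0] * (phi R : 'rV_2) 0 1 = G.@[R 0] * (phi R : 'rV_2) 0 0.
  move=> gEG; have [/gEG //|] := boolP ((E.@[R 0] != 0) || (G.@[R 0] != 0)).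
  by rewrite negb_or !negbK => /andP[/eqP -> /eqP ->]; rewrite !mul0r.
have cross (R : Cpoint C) : A0.@[R 0] * B'.@[R 0] = A'.@[R 0] * B0.@[R 0].
  have e1 := trivial_given _ _ R gAB0; have e2 := trivial_given _ _ R gAB.
  have : ((phi R : 'rV_2) 0 0 != 0) || ((phi R : 'rV_2) 0 1 != 0).
    have /andP[/existsP[j /andP[/eqP Rj _]] _] := coordsP (phi R).
    have : (phi R : 'rV_2) 0 j != 0 by rewrite Rj oner_neq0.
    case: j {Rj} => [[|[|//]] j2] nzj; apply/orP; [left|right].
      by rewrite (_ : 0 = Ordinal j2 :> 'I_2) //; apply: val_inj.
    by rewrite (_ : 1 = Ordinal j2 :> 'I_2) //; apply: val_inj.
  case/orP=> n0; apply: (mulIf n0).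
    by rewrite -mulrA -e2 -[RHS]mulrA -e1 mulrCA.
  by rewrite mulrAC e1 [RHS]mulrAC e2 mulrC [RHS]mulrAC mulrA.
have [hA' hB'] := (dhomog_map_ratr hA, dhomog_map_ratr hB).
have [[e /= [_ hB0]] nB0] := fAB0.
have nB : ~ vanishes (C := C) B'.
  move=> vB; have [|vA|//] := @vanishesM C _ _ A' B0 hA' hB0.
    by move=> R; rewrite mevalM -cross vB mulr0.
  by move: nz; rewrite vA vB eqxx.
have fAB : is_fraction (C := C) (A', B') by split=> //; exists d.
split=> //; split; first exact: fAB.
rewrite tE; apply/ratioP; [exact: fAB0|exact: fAB|move=> R].
by rewrite mevalB !mevalM cross subrr.
Qed.

(** * Points over quartic fields *)

Lemma injective_pair (T : eqType) n (P : 'I_n -> T) (a b : T) : injective P ->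
  (forall i, P i = a \/ P i = b) -> (n <= 2)%N.
Proof.
move=> injP Pab; have <- : size [seq P i | i <- enum 'I_n] = n.
  by rewrite size_map size_enum_ord.
apply: (@uniq_leq_size _ _ [:: a; b]); first by rewrite map_inj_uniq ?enum_uniq.
by move=> _ /mapP[i _ ->]; rewrite !inE; case: (Pab i) => ->; rewrite eqxx ?orbT.
Qed.

Section TrivialJacobian.
Variables (C : curve) (g : nat) (x0 : Cpoint C) (t : funfield C).
Hypotheses (hg : genus C g) (g2 : (2 <= g)%N) (hJ : JQ_trivial C).
Hypotheses (dt : dep (cst C) 2 t) (t_local : forall P, exists A B, local_form t P A B).
Implicit Types (P Q R : Cpoint C) (s : {rmorphism algC -> algC}).
Notation hvC := (@has_value C).

Let pl := curve_places C.
Let rg := curve_riemann hg.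
Let g2Z : 2 <= g%:Z.
Proof. by rewrite lez_nat. Qed.

Lemma coordinate_neq0 : t != 0.
Proof.
apply/eqP=> t0; apply: (dep_nonconstant pl x0 rg dt); exists 0; rewrite t0.
by rewrite rmorph0.
Qed.

Let t0 := coordinate_neq0.
Let t_place := coordinate_place t_local.

Lemma principal0 : principal (0 : divisor C).
Proof.
exists (cst C 1); split; first by rewrite fmorph_eq0 oner_neq0.
by move=> P; rewrite coeff0; apply: (horder_cst pl x0 rg P (oner_neq0 _)).
Qed.

Lemma invariant_principal (D : divisor C) : deg D = 0 ->
  (forall s, galois_divisor s D = D) -> principal D.
Proof.
move=> D0 sD; have : lin_equiv D 0.
  by apply: hJ; split=> // s; rewrite /lin_equiv sD subrr; apply: principal0.
by rewrite /lin_equiv subr0.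
Qed.

Lemma galois_fixed_uniq P Q : galois_fixed P -> galois_fixed Q -> P = Q.
Proof.
move=> fP fQ; apply/eqP/negPn/negP=> PQ.
have [||f [_ fD]] := @invariant_principal (<<P>> - <<Q>>).
- by rewrite degB !degU subrr.
- by move=> s; rewrite raddfB /= !galois_divisorU fP fQ.
by have := no_degree_one pl x0 rg dt t_place PQ fD; lia.
Qed.

Lemma value_pair c : exists P Q, forall R, hvC R t c <-> R = P \/ R = Q.
Proof. exact: (fibre_pair pl x0 rg dt t_place (erefl 2%N) g2Z c). Qed.

Lemma pair_invariant P Q s :
  (forall R, R = P \/ R = Q -> galois_point s R = P \/ galois_point s R = Q) ->
  galois_divisor s (<<P>> + <<Q>>) = <<P>> + <<Q>>.
Proof.
move=> sPQ; rewrite raddfD /= !galois_divisorU.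
have [PQ|PQ] := eqVneq P Q.
  by rewrite -PQ in sPQ *; have [|->|->] := sPQ P; [left|..].
have sPsQ : galois_point s P != galois_point s Q by rewrite (inj_eq (@galois_point_inj C s)).
have [|sP|sP] := sPQ P; first by left.
  have [|sQ|sQ] := sPQ Q; first by right.
    by rewrite sP sQ eqxx in sPsQ.
  by rewrite sP sQ.
have [|sQ|sQ] := sPQ Q; first by right.
  by rewrite sP sQ addrC.
by rewrite sP sQ eqxx in sPsQ.
Qed.

Lemma sum_invariant n (P : 'I_n -> Cpoint C) s : injective P ->
  (forall i, exists j, galois_point s (P i) = P j) ->
  galois_divisor s (\sum_i <<P i>>) = \sum_i <<P i>>.
Proof.
move=> injP /choice [h hP]; rewrite galois_divisor_sum.
under eq_bigr do rewrite hP.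
rewrite [RHS](reindex_inj (h := h)) // => i j hij.
by apply/injP/(@galois_point_inj C s); rewrite !hP hij.
Qed.

(* The sum of the orbit is linearly equivalent to twice the polar divisor of t. *)
Lemma quartic_orbit (P : 'I_4 -> Cpoint C) : injective P ->
  (forall s i, exists j, galois_point s (P i) = P j) ->
  exists p : {poly algC}, [/\ p != 0, (size p <= 3)%N &
    forall i c, hvC (P i) t c -> root p c].
Proof.
move=> injP sP.
have [A [B [regAB spanAB]]] := hyperelliptic_poles pl x0 rg dt t_place (erefl 2%N) g2Z.
pose S : divisor C := \sum_i <<P i>>; pose E : divisor C := (<<A>> + <<B>>) *+ 2.
have degS : deg S = 4.
  rewrite raddf_sum /= (eq_bigr (fun=> 1)) => [|i _]; last by rewrite degU.
  by rewrite sumr_const card_ord.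
have degE : deg E = 4 by rewrite degMn degD !degU.
have [||f [f0 fD]] := @invariant_principal (S - E).
- by rewrite degB degS degE subrr.
- move=> s; rewrite raddfB raddfMn /= sum_invariant ?pair_invariant // => R RAB.
  apply: contrapT => nsR; have : ~ regular hvC R t by move/regAB; case: RAB; tauto.
  by apply; apply/(regular_galois t_local t0 s)/regAB; tauto.
have coeffS R : (0 : int) <= coeff R S.
  by rewrite raddf_sum; apply: sumr_ge0 => i _ /=; rewrite coeffU mul1r ler0n.
have [|p p3 fE] := spanAB f.
  right=> R; exists (coeff R (S - E)); split; first exact: fD.
  by rewrite coeffB lerDr coeffS.
exists p; split=> //.
  by apply: contra_neq f0; rewrite fE => ->; rewrite ev0.
move=> i c tc; apply/eqP; apply: (hv_inj pl (hv_ev pl p tc)); rewrite -fE.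
apply: (horder_gt0 pl x0 rg (fD (P i))).
have [PA PB] : P i <> A /\ P i <> B by apply/regAB; exists c.
rewrite coeffB coeffMn coeffD !coeffU !mul1r.
rewrite !(introF eqP (fun e => _ (esym e))) //= ?addr0 ?mul0rn ?subr0.
rewrite raddf_sum /= (bigD1 i) //= coeffU eqxx mulr1 ltr_wpDr //.
by apply: sumr_ge0 => j _; rewrite coeffU mul1r ler0n.
Qed.

Lemma poles_pair : exists P Q, forall R, regular hvC R t <-> R <> P /\ R <> Q.
Proof.
have [A [B [regAB _]]] := hyperelliptic_poles pl x0 rg dt t_place (erefl 2%N) g2Z.
by exists A, B.
Qed.

Lemma primitive_generator (K : fieldExtType rat) (x : K) : primitive_field K ->
  x \notin 1%VS -> <<1; x>>%VS = fullv.
Proof.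
move=> prim nx; have [E|E] := prim <<1; x>>%AS; last by rewrite -[RHS]/(asval {: K}%AS) -E.
by case/negP: nx; have := memv_adjoin 1 x; rewrite -[<<1; x>>%VS]/(asval <<1; x>>%AS) E.
Qed.

Lemma primitive_quartic (K : fieldExtType rat) : \dim {: K} = 4%N -> primitive_field K ->
  no_new_points C (in_alg K).
Proof.
move=> dim4 prim P; have [Prat|] := EM (forall j, P 0 j \in 1%VS).
  have /choice [a aE] : forall j, exists a, P 0 j = in_alg K a.
    by move=> j; have /vlineP [a ->] := Prat j; exists a.
  have PE : coords P = map_mx (in_alg K) (\row_j a j) by apply/rowP=> j; rewrite !mxE aE.
  have vP : normalized (\row_j a j) && on_scheme (X := C) idfun (\row_j a j).
    by rewrite -(point_morphism (in_alg K) idfun (in_alg K)) -PE; apply: coordsP.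
  by exists (Point vP).
move=> /existsNP[j0 /negP Pj0]; exfalso.
have gen := primitive_generator prim Pj0.
have [f0 [inj0 gal0]] := embeddings gen.
have [f [injf galf]] : exists f : 'I_4 -> {rmorphism K -> algC},
    injective (fun i => f i (P 0 j0)) /\ forall s i, exists j, forall y, s (f i y) = f j y.
  by move: f0 inj0 gal0; rewrite dim4 => f *; exists f.
have fP i : normalized (map_mx (f i) P) && on_scheme (X := C) ratr (map_mx (f i) P).
  by rewrite (point_morphism (f i) (in_alg K) ratr); apply: coordsP.
pose Q i : Cpoint C := Point (fP i).
have injQ : injective Q.
  move=> i j /(congr1 (@coords _ _ _)) /matrixP /(_ 0 j0); rewrite !mxE; exact: injf.
have galQ s i : exists j, galois_point s (Q i) = Q j.
  have [j sf] := galf s i; exists j; apply: val_inj; apply/rowP=> l.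
  by rewrite /= !mxE sf.
have Qev i (G : {mpoly rat[(amb C).+1]}) :
    (map_mpoly ratr G).@[Q i 0] = f i (map_mpoly (in_alg K) G).@[P 0].
  by apply: meval_morphism => l; rewrite mxE.
have [p [p0 p3 pQ]] := quartic_orbit injQ galQ.
have [A [B AB]] := t_local (Q ord0); have [rAB nz] := AB.
pose a := (map_mpoly (in_alg K) A).@[P 0]; pose b := (map_mpoly (in_alg K) B).@[P 0].
have nzab : (a != 0) || (b != 0).
  move: nz; rewrite (Qev ord0 A) (Qev ord0 B) -/a -/b.
  by rewrite (fmorph_eq0 (f ord0) a) (fmorph_eq0 (f ord0) b).
have ABi i : local_form t (Q i) A B.
  split; first exact: rAB.
  by rewrite (Qev i A) (Qev i B) -/a -/b (fmorph_eq0 (f i) a) (fmorph_eq0 (f i) b).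
have [b0|b0] := eqVneq b 0.
  have [R [R' polesR]] := poles_pair.
  suff /(injective_pair injQ) : forall i, Q i = R \/ Q i = R' by [].
  move=> i; apply: contrapT => nQ; have : regular hvC (Q i) t by apply/polesR; tauto.
  by move/(local_denominator t0 (ABi i)); rewrite Qev -/b b0 rmorph0 eqxx.
have val_i i : hvC (Q i) t (f i (a / b)).
  have BQ : (map_mpoly ratr B).@[Q i 0] != 0 by rewrite Qev fmorph_eq0.
  by have := local_value (ABi i) BQ; rewrite !Qev -fmorph_div.
have [ab1|ab1] := boolP (a / b \in 1%VS).
  have /vlineP [c cE] := ab1; have [R [R' valR]] := value_pair (ratr c).
  suff /(injective_pair injQ) : forall i, Q i = R \/ Q i = R' by [].
  move=> i; apply/valR; have := val_i i.
  by rewrite cE rmorphZ_num rmorph1 mulr1.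
have genab := primitive_generator prim ab1.
have injab : injective (fun i => f i (a / b)).
  by move=> i j /(embedding_eq genab) fij; apply: injf; apply: fij.
pose rs := [seq f i (a / b) | i <- enum 'I_4].
have rootrs : all (root p) rs by apply/allP=> _ /mapP[i _ ->]; apply: pQ (val_i i).
have urs : uniq rs by rewrite map_inj_uniq ?enum_uniq.
by have := leq_trans (max_poly_roots p0 rootrs urs) p3; rewrite size_map size_enum_ord.
Qed.

Lemma quadratic_orbit : exists P Q,
  (forall s, galois_point s P = P \/ galois_point s P = Q) /\ ~ galois_fixed P.
Proof.
have fib (c : rat) : exists P Q,
    hvC P t (ratr c) /\ forall s, galois_point s P = P \/ galois_point s P = Q.
  have [P [Q PQ]] := value_pair (ratr c); have Pc : hvC P t (ratr c) by apply/PQ; left.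
  exists P, Q; split=> // s; apply/PQ.
  by have := value_galois t_local t0 s Pc; rewrite fmorph_rat.
have [[P [Q [P0 sP]]] [P' [Q' [P1 sP']]]] := (fib 0, fib 1).
have [fP|] := EM (galois_fixed P); last by exists P, Q.
exists P', Q'; split=> // fP'; rewrite (galois_fixed_uniq fP fP') in P0.
by have /fmorph_inj/eqP := hv_inj pl P0 P1; rewrite eq_sym oner_eq0.
Qed.

End TrivialJacobian.

Section QuadraticPoint.
Variable C : curve.
Implicit Types (P Q R : Cpoint C) (s : {rmorphism algC -> algC}).

(* If x, x' are the two conjugates of some coordinate of P then m is a multiple of (x - x')^2. *)
Lemma orbit_pair_quadratic P Q : (forall s, galois_point s P = P \/ galois_point s P = Q) ->
  ~ galois_fixed P ->
  exists (m : int) (d : algC), [/\ d ^+ 2 = m%:~R, d \notin Crat &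
    forall j, exists a b : rat, P 0 j = ratr a + ratr b * d].
Proof.
move=> orbP /existsNP [s0 s0P]; have s0Q : galois_point s0 P = Q by case: (orbP s0).
have PQ : P <> Q by move=> E; apply: s0P; rewrite s0Q.
have [j0 xx'] : exists j, P 0 j != Q 0 j.
  apply: contrapT => /forallNP nj; apply: PQ; apply: val_inj; apply/rowP => j.
  by apply/eqP/negPn/negP/nj.
have sx s R j : s (R 0 j) = (galois_point s R : 'rV__) 0 j by rewrite mxE.
have sQ s : (galois_point s P = P /\ galois_point s Q = Q) \/
            (galois_point s P = Q /\ galois_point s Q = P).
  pose s' : {rmorphism algC -> algC} := s \o s0.
  have s'P : galois_point s Q = galois_point s' P.
    by apply: val_inj; apply/rowP=> j; rewrite -s0Q /= !mxE.
  have neq : galois_point s Q <> galois_point s P.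
    by move/(@galois_point_inj C s)/esym.
  case: (orbP s) => sP; rewrite sP in neq; [left|right]; split=> //.
    by rewrite s'P; case: (orbP s') => // E; case: neq; rewrite s'P.
  by rewrite s'P; case: (orbP s') => // E; case: neq; rewrite s'P.
pose dl := P 0 j0 - Q 0 j0.
have dl0 : dl != 0 by rewrite subr_eq0.
have sdl s : (forall j, s (P 0 j) = P 0 j /\ s (Q 0 j) = Q 0 j) /\ s dl = dl \/
             (forall j, s (P 0 j) = Q 0 j /\ s (Q 0 j) = P 0 j) /\ s dl = - dl.
  case: (sQ s) => -[sP sQ']; [left|right]; split=> [j|].
  - by rewrite !sx sP sQ'.
  - by rewrite rmorphB !sx sP sQ'.
  - by rewrite !sx sP sQ'.
  - by rewrite rmorphB !sx sP sQ' opprB.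
have [m0 m0E] : exists m0, dl ^+ 2 = ratr m0.
  by apply: fixed_rational => s; rewrite rmorphXn; case: (sdl s) => -[_ ->] //=; rewrite sqrrN.
have ndl : dl \notin Crat.
  apply/negP => /CratP [a aE]; have [[E _]|[E1 E2]] := sQ s0; first exact: s0P.
  have sd : s0 dl = - dl by rewrite rmorphB !sx E1 E2 opprB.
  have : dl *+ 2 = 0 by rewrite mulr2n -{1}[dl]opprK -sd aE fmorph_rat addNr.
  by move/eqP; rewrite mulrn_eq0 (negbTE dl0).
have coordP j : exists a b : rat, P 0 j = ratr a + ratr b * dl.
  have [a aE] : exists a, (P 0 j + Q 0 j) / 2 = ratr a.
    apply: fixed_rational => s; rewrite fmorph_div rmorphD rmorph_nat.
    by case: (sdl s) => -[/(_ j) [-> ->] _] //; rewrite addrC.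
  have [b bE] : exists b, (P 0 j - Q 0 j) / (2 * dl) = ratr b.
    apply: fixed_rational => s; rewrite fmorph_div rmorphB rmorphM rmorph_nat.
    by case: (sdl s) => -[/(_ j) [-> ->] ->] //; rewrite -opprB mulrN invrN mulrNN.
  by exists a, b; rewrite -aE -bE; field.
pose n : algC := (denq m0)%:~R.
have n0 : n != 0 by rewrite intr_eq0 denq_neq0.
exists (numq m0 * denq m0), (n * dl); split.
- have m0q : ratr m0 = (numq m0)%:~R / n by rewrite -{1}[m0]divq_num_den fmorph_div /= !ratr_int.
  by rewrite exprMn m0E intrM m0q -/n; field.
- apply: contra ndl => /CratP [c cE]; apply/CratP; exists (c / (denq m0)%:~R).
  by rewrite fmorph_div /= -cE ratr_int -/n mulrC mulKf.
move=> j; have [a [b ->]] := coordP j; exists a, (b / (denq m0)%:~R).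
by rewrite fmorph_div /= ratr_int mulrA divfK.
Qed.

End QuadraticPoint.

Section Biquadratic.
Variables (m : int) (d : algC).
Hypotheses (dm : d ^+ 2 = m%:~R) (nd : d \notin Crat).
Notation pQtoC := (map_poly (ratr : rat -> algC)).

Definition qd (z : algC) : Prop := exists a b : rat, z = ratr a + ratr b * d.

Lemma qd_rat a : qd (ratr a).
Proof. by exists a, 0; rewrite rmorph0 mul0r addr0. Qed.

Lemma qdD x y : qd x -> qd y -> qd (x + y).
Proof.
move=> [a [b ->]] [a' [b' ->]]; exists (a + a'), (b + b').
by rewrite !rmorphD /=; ring.
Qed.

Lemma qdM x y : qd x -> qd y -> qd (x * y).
Proof.
move=> [a [b ->]] [a' [b' ->]]; exists (a * a' + b * b' * m%:~R), (a * b' + a' * b).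
by rewrite !rmorphD !rmorphM /= ratr_int -dm; ring.
Qed.

Lemma qdN x : qd x -> qd (- x).
Proof. by move=> [a [b ->]]; exists (- a), (- b); rewrite !rmorphN /=; ring. Qed.

Lemma qdV x : qd x -> qd x^-1.
Proof.
move=> [a [b ->]]; have [-> | x0] := eqVneq (ratr a + ratr b * d) 0.
  by rewrite invr0 -(rmorph0 (ratr : {rmorphism rat -> algC})); apply: qd_rat.
have y0 : ratr a - ratr b * d != 0.
  apply: contra_neq x0 => /eqP; rewrite subr_eq0 => /eqP E.
  have [b0|b0] := eqVneq b 0; first by rewrite E b0 rmorph0 mul0r addr0.
  case/negP: nd; apply/CratP; exists (a / b).
  by rewrite fmorph_div /= E mulrAC mulfV ?mul1r // fmorph_eq0.
pose N := a * a - b * b * m%:~R.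
have NE : ratr N = (ratr a + ratr b * d) * (ratr a - ratr b * d).
  by rewrite rmorphB !rmorphM /= ratr_int -dm; ring.
exists (a / N), (- b / N); rewrite !fmorph_div /= NE rmorphN /=; field.
by rewrite x0 y0.
Qed.

Lemma qd_poly (q : {poly rat}) : qd (pQtoC q).[d].
Proof.
elim/poly_ind: q => [|q c IH].
  by rewrite rmorph0 horner0 -(rmorph0 (ratr : {rmorphism rat -> algC})); apply: qd_rat.
rewrite rmorphD rmorphM /= map_polyX map_polyC !hornerE; apply: qdD; last exact: qd_rat.
by apply: qdM => //; exists 0, 1; rewrite rmorph0 rmorph1 mul1r add0r.
Qed.

Lemma qd_prime_square (p : nat) z : prime p -> ~~ (p %| `|m|)%N -> qd z -> z ^+ 2 <> p%:R.
Proof.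
move=> pp pm [a [b ->]] E; have Cp : (p%:R : algC) \in Crat.
  by apply/CratP; exists p%:R; rewrite rmorph_nat.
have [|] := quadratic_square dm nd Cp E; last exact: prime_not_square.
rewrite -[X in _ = X]mulr1 -[1]/(1%:~R); apply: prime_not_square => //.
by rewrite absz1 dvdn1; apply: contraTneq pp => ->.
Qed.

Lemma qde_prime_square (p q : nat) u v e : prime p -> prime q -> p != q ->
  ~~ (p %| `|m|)%N -> ~~ (q %| `|m|)%N -> e ^+ 2 = q%:R ->
  qd u -> qd v -> (u + v * e) ^+ 2 <> p%:R.
Proof.
move=> pp pq pneq pm qm eq qu qv E.
have [v0|v0] := eqVneq v 0.
  by apply: (qd_prime_square pp pm qu); rewrite -E v0 mul0r addr0.
have Cn (n : nat) : qd n%:R by have := qd_rat n%:R; rewrite rmorph_nat.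
have [u0|u0] := eqVneq u 0; last first.
  apply: (qd_prime_square pq qm (z := e)); last exact: eq.
  have -> : e = (p%:R + - (u * u) + - (v * v * q%:R)) * (2%:R * u * v)^-1.
    by rewrite -E -eq; field; rewrite u0 v0.
  by apply: qdM; [do 2?apply: qdD; try apply: qdN; do ?apply: qdM|apply: qdV; do ?apply: qdM].
have q0 : (q%:R : algC) != 0 by rewrite pnatr_eq0 -lt0n prime_gt0.
have vv : v ^+ 2 = ratr (p%:R / q%:R).
  by rewrite fmorph_div /= !rmorph_nat -E u0 add0r exprMn eq mulfK.
have [a [b vE]] := qv; rewrite vE in vv.
have pnq : ~~ (p %| q)%N by rewrite dvdn_prime2.
have [E1|E1] := quadratic_square dm nd (Crat_rat _) vv.
  apply: (@prime_not_square p q%:Z a) => //.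
  by rewrite -E1 fmorph_div /= !rmorph_nat -pmulrn divfK.
apply: (@prime_not_square p (m * q%:Z) b) => //.
  by rewrite abszM Euclid_dvdM // negb_or pm.
by rewrite intrM mulrA -E1 fmorph_div /= !rmorph_nat -pmulrn divfK.
Qed.

Lemma quadratic_degree (K : fieldExtType rat) (E : {subfield K}) (x : K) :
  x ^+ 2 \in E -> x \notin E -> adjoin_degree E x = 2%N.
Proof.
move=> x2 nx; apply/eqP; rewrite eqn_leq -ltnS -size_minPoly; apply/andP; split; last first.
  by rewrite ltn_neqAle eq_sym adjoin_deg_eq1 nx.
have s3 : size ('X^2 - (x ^+ 2)%:P) = 3%N by rewrite size_XnsubC.
rewrite -s3; apply: dvdp_leq; first by rewrite -size_poly_eq0 s3.
apply: minPoly_dvdp; last by rewrite /root !hornerE subrr.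
by rewrite rpredB ?rpredX ?polyOverX ?polyOverC.
Qed.

Section Field.
Variables (p : nat) (K : fieldExtType rat) (KC : {rmorphism K -> algC}) (d1 e1 : K).
Hypotheses (pp : prime p) (pm : ~~ (p %| `|m|)%N).
Hypotheses (d1E : KC d1 = d) (e1E : KC e1 ^+ 2 = p%:R) (gen : <<1 & [:: d1; e1]>>%VS = fullv).

Let L := <<1; d1>>%AS.

Lemma qd_mem y : y \in L -> qd (KC y).
Proof.
case/Fadjoin_polyP => q /polyOver1P [r ->] ->.
by rewrite -horner_map in_alg_map_poly d1E; apply: qd_poly.
Qed.

Lemma d1_notin : d1 \notin 1%VS.
Proof.
apply: contra nd => /vlineP [a E]; apply/CratP; exists a.
by rewrite -d1E E rmorphZ_num rmorph1 mulr1.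
Qed.

Lemma e1_notin : e1 \notin L.
Proof. by apply/negP=> /qd_mem /(qd_prime_square pp pm); apply. Qed.

Lemma d1_sq : d1 ^+ 2 \in 1%VS.
Proof.
have -> : d1 ^+ 2 = m%:~R by apply: (fmorph_inj KC); rewrite rmorphXn d1E dm rmorph_int.
by rewrite rpred_int.
Qed.

Lemma e1_sq : e1 ^+ 2 = p%:R.
Proof. by apply: (fmorph_inj KC); rewrite rmorphXn e1E rmorph_nat. Qed.

Lemma genL : <<L; e1>>%VS = fullv.
Proof. by rewrite -gen adjoin_cons adjoin_seq1. Qed.

Lemma dimL : \dim L = 2%N.
Proof. by rewrite dim_Fadjoin quadratic_degree ?d1_sq ?d1_notin // dimv1. Qed.

Lemma dim_biquadratic : \dim {:K} = 4%N.
Proof.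
by rewrite -genL dim_Fadjoin quadratic_degree ?e1_notin ?dimL // e1_sq rpred_nat.
Qed.

Lemma biquadratic_imprimitive : ~ primitive_field K.
Proof.
move=> /(_ L) [E|E]; have := dimL; rewrite E ?dimv1 //.
by rewrite -[asval {:K}%AS]/(fullv : {vspace K}) dim_biquadratic.
Qed.

Lemma biquadratic_elements y : exists u v, [/\ qd u, qd v & KC y = u + v * KC e1].
Proof.
have : y \in <<L; e1>>%VS by rewrite genL memvf.
case/Fadjoin_polyP => q /polyOverP Lq ->; rewrite horner_coef rmorph_sum.
have q0 : qd 0 by have := qd_rat 0; rewrite rmorph0.
elim/big_rec: _ => [|i z _ [u [v [qu qv ->]]]]; first by exists 0, 0; rewrite mul0r addr0.
have qi := qd_mem (Lq i); rewrite rmorphM rmorphXn /=.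
have [w [w' [qw qw' ->]]] : exists w w', [/\ qd w, qd w' & KC e1 ^+ i = w + w' * KC e1].
  have Cn (n : nat) : qd n%:R by have := qd_rat n%:R; rewrite rmorph_nat.
  elim: (i : nat) => [|l [w [w' [qw qw' IH]]]].
    by exists 1, 0; rewrite mul0r addr0; split=> //; apply: (Cn 1%N).
  exists (w' * p%:R), w; split=> //; first exact: qdM.
  by rewrite exprSr IH -e1E; ring.
exists (KC q`_i * w + u), (KC q`_i * w' + v); split; try by apply: qdD => //; apply: qdM.
by ring.
Qed.

End Field.
End Biquadratic.

Lemma increasing_primes (n : nat) : exists p : nat -> nat,
  injective p /\ forall i, prime (p i) /\ (n < p i)%N.
Proof.
have /choice [next nextP] : forall l : nat, exists q, (l < q)%N /\ prime q.
  by move=> l; have [q lq qp] := prime_above l; exists q.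
pose p i := iter i next (next n).
have mono i : (p i < p i.+1)%N by case: (nextP (p i)).
have lt_p : {homo p : i j / (i < j)%N} by apply: homo_ltn => //; apply: ltn_trans.
exists p; split=> [i j pij|i].
  by case: (ltngtP i j) => // /lt_p; rewrite pij ltnn.
split; first by case: i => [|i]; exact: (nextP _).2.
elim: i => [|i IH]; first exact: (nextP n).1.
exact: ltn_trans IH (mono i).
Qed.

Lemma biquadratic_fields (m : int) (d : algC) : d ^+ 2 = m%:~R -> d \notin Crat ->
  exists K : nat -> fieldExtType rat,
    (forall i, [/\ \dim {: K i} = 4%N, ~ primitive_field (K i) &
       exists (f : {rmorphism K i -> algC}) (d1 : K i), f d1 = d]) /\
    (forall i j, i <> j -> ~ field_iso (K i) (K j)).
Proof.
move=> dm nd; have m0 : m != 0.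
  apply: contraNneq nd => m0; move/eqP: dm; rewrite m0 expf_eq0 => /eqP ->.
  exact: rpred0.
have [p [injp pP]] := increasing_primes `|m|.
have pp i : prime (p i) by case: (pP i).
have pm i : ~~ (p i %| `|m|)%N by rewrite gtnNdvd ?absz_gt0 //; case: (pP i).
pose e i : algC := sqrtC (p i)%:R.
pose K i := projT1 (num_field_exists [:: d; e i]).
have KP i : exists (f : {rmorphism K i -> algC}) (d1 e1 : K i),
    [/\ f d1 = d, f e1 ^+ 2 = (p i)%:R & <<1 & [:: d1; e1]>>%VS = fullv].
  rewrite /K; case: num_field_exists => Q [f [s1 sE gen]] /=.
  case: s1 sE gen => [|d1 [|e1 []]] // [fd fe] gen.
  by exists f, d1, e1; rewrite fe sqrtCK.
exists K; split=> [i|i j ij [h _]].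
  have [f [d1 [e1 [fd fe gen]]]] := KP i.
  split; first exact: (dim_biquadratic dm nd (pp i) (pm i) fd fe gen).
    exact: (biquadratic_imprimitive dm nd (pp i) (pm i) fd fe gen).
  by exists f, d1.
have [f [d1 [e1 [fd fe gen]]]] := KP i; have [f' [d1' [e1' [fd' fe' gen']]]] := KP j.
have [u [v [qu qv E]]] := biquadratic_elements dm fd' fe' gen' (h e1).
have pij : p i != p j by apply/eqP=> /injp.
apply: (qde_prime_square dm nd (pp i) (pp j) pij (pm i) (pm j) fe' qu qv).
have -> : u + v * f' e1' = f' (h e1) by [].
by rewrite -!rmorphXn (e1_sq fe) !rmorph_nat.
Qed.

Theorem theorem1p3 (C : curve) (g : nat) (hC : hyperelliptic C)
    (hg : genus C g) (hg23 : g = 2%N \/ g = 3%N) (hJ : JQ_trivial C) :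
  (forall K : fieldExtType rat,
     \dim {: K} = 4%N -> primitive_field K -> no_new_points C (in_alg K)) /\
  (exists K : nat -> fieldExtType rat,
     (forall i, [/\ \dim {: K i} = 4%N, ~ primitive_field (K i) &
                    ~ no_new_points C (in_alg (K i))]) /\
     (forall i j, i <> j -> ~ field_iso (K i) (K j))).
Proof.
have g2 : (2 <= g)%N by case: hg23 => ->.
have [[x0 _] _] := geom_irreducible C.
have [t [dt t_local]] := hyperelliptic_coordinate hC.
split=> [K dim4 prim|]; first exact: (primitive_quartic x0 hg g2 hJ dt t_local dim4 prim).
have [P [Q [orbP nfP]]] := quadratic_orbit x0 hg g2 hJ dt t_local.
have [m [d [dm nd Pd]]] := orbit_pair_quadratic orbP nfP.
have [K [KP Kiso]] := biquadratic_fields dm nd.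
exists K; split=> // i; have [dim4 nprim [f [d1 fd1]]] := KP i; split=> // noP.
have /choice [a /choice [b abE]] := Pd.
pose v := \row_j (in_alg (K i) (a j) + in_alg (K i) (b j) * d1).
have vE : map_mx f v = P.
  apply/rowP=> j; rewrite !mxE rmorphD rmorphM fd1.
  by rewrite !(rat_morphism_eq f (in_alg (K i)) ratr) abE.
have vP : normalized v && on_scheme (X := C) (in_alg (K i)) v.
  by rewrite -(point_morphism f (in_alg (K i)) ratr) vE; apply: coordsP.
have [R /= vR] := noP (Point vP); apply: nfP => s; apply: val_inj; apply/rowP => j.
rewrite /= mxE -vE vR !mxE (rat_morphism_eq f (in_alg (K i)) ratr).
exact: fmorph_rat.
Qed.
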